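(* Let $G=(V,E)$ be a finite 4-connected grid graph and let $s,t\in V$. The algorithm KIA* (Key-Interval A* ), run on $(G,s,t)$, returns a valid path from $s$ to $t$ in $G$ if one exists, and reports failure otherwise.
   Context: **Grid.** An $M\times N$ grid has cells $(x,y)$, $x$ increasing left to right, $y$ increasing top to bottom. $V\subseteq\mathbb{Z}^2$ is the set of traversable cells; cells outside the grid are non-traversable. Two vertices $(x_1,y_1),(x_2,y_2)\in V$ are adjacent iff $|x_1-x_2|+|y_1-y_2|=1$; edges have unit cost. For a vertex $v=(x,y)$ write $v.x=x$, $v.y=y$. A (valid) path from $s$ to $t$ is a sequence $\langle v_0,\dots,v_k\rangle$ of vertices with $v_0=s$, $v_k=t$, consecutive vertices adjacent; its length is $k$. $\mathcal{C}_M(a,b)=|a.x-b.x|+|a.y-b.y|$. **Intervals.** A vertical interval is a maximal contiguous run of traversable cells in one column, written $I=\langle x,y_s,y_e\rangle$ (cells $(x,y)$, $y_s\le y\le y_e$, traversable; $(x,y_s-1),(x,y_e+1)$ non-traversable); $(x,y_s)$ is its start vertex, $(x,y_e)$ its end vertex. A horizontal interval $\langle y,x_s,x_e\rangle$ is defined analogously along rows. For vertical intervals, $I'=\langle x',y_s',y_e'\rangle$ is a direct neighbor of $I$ if $|x'-x|=1$ and $[y_s,y_e]\cap[y'_s,y'_e]\ne\emptyset$. $N_d(I)$ is the set of direct neighbors, $N_d^l(I)$ those with $x'=x-1$ (left), $N_d^r(I)$ those with $x'=x+1$ (right). **Key points.** Vertical scan: for each vertical interval $I=\langle x,y_s,y_e\rangle$,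 scanning columns left to right, define trends $T_s(I),T_e(I)\in\{\mathrm{UP},\mathrm{DOWN},\mathrm{LEVEL}\}$. If $N_d^l(I)=\emptyset$, both are LEVEL. Otherwise let $I^l_{\min}$ be the left direct neighbor with smallest $y_s$, $I^l_{\max}$ the one with largest $y_e$, $\Delta_s=I.y_s-I^l_{\min}.y_s$, $\Delta_e=I.y_e-I^l_{\max}.y_e$. $T_s(I)$ is DOWN if $\Delta_s>0$, UP if $\Delta_s<0$, and $T_s(I^l_{\min})$ if $\Delta_s=0$; $T_e(I)$ is DOWN if $\Delta_e>0$, UP if $\Delta_e<0$, and $T_e(I^l_{\max})$ if $\Delta_e=0$. If $N_d^r(I)\neq\emptyset$, let $I^r_{\min}$, $I^r_{\max}$ be the right direct neighbors with smallest $y_s$, resp. largest $y_e$; the start vertex $(x,y_s)$ is labeled $\downarrow$ if $T_s(I)=\mathrm{DOWN}$ and $I^r_{\min}.y_s<I.y_s$; the end vertex $(x,y_e)$ is labeled $\uparrow$ if $T_e(I)=\mathrm{UP}$ and $I^r_{\max}.y_e>I.y_e$. If $N_d^r(I)=\emptyset$, no label. Horizontal scan: the same procedure with the roles of $x$ and $y$ exchanged (horizontal intervals, rows scanned top to bottom, ''left'' neighbors replaced by neighbors in the previous row $y-1$, ''right'' by neighbors in row $y+1$, UP/DOWN replaced by LEFT/RIGHT), giving start vertices labeled $\rightarrow$ and end vertices labeled $\leftarrow$. A key point is a vertex receiving at least one label ($\uparrow,\downarrow,\leftarrow,\rightarrow$). **Key intervals and non-key components.** A key interval is a vertical interval containing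 at least one key point (of any label); $\mathcal{K}$ is the set of key intervals. For $K\in\mathcal{K}$, $K.\mathrm{up}$ (resp. $K.\mathrm{down}$) is its $\uparrow$-labeled end vertex (resp. $\downarrow$-labeled start vertex) if present. Every non-key vertical interval has at most one left and at most one right direct neighbor, so the non-key vertical intervals form disjoint non-branching chains under the direct-neighbor relation; each maximal such chain (connected component of the direct-neighbor relation restricted to non-key intervals) is a non-key component $C$. $\mathcal{B}(C)=\{K\in\mathcal{K}: \exists I\in C,\ K\in N_d(I)\}$ and $\overline{C}=C\cup\mathcal{B}(C)$. A vertex lies in $\overline C$ if the vertical interval containing it belongs to $\overline C$. Vertices $a,b$ share a non-key context if some non-key component $C$ has $a,b\in\overline C$. **Chains and key-interval graph.** A horizontally monotone interval chain is a sequence $\Gamma=(I_0,\dots,I_m)$, $m\ge1$, of vertical intervals with $I_{i+1}\in N_d(I_i)$ and a fixed $d\in\{-1,+1\}$ with $I_{i+1}.x=I_i.x+d$ for all $i$; $\operatorname{exit}(\Gamma)=I_1$, $\operatorname{entry}(\Gamma)=I_{m-1}$. For distinct $I_a,I_b\in\overline C$, $\Gamma_C(I_a,I_b)$ is the unique horizontally monotone interval chain in $\overline C$ from $I_a$ to $I_b$ with all intermediate intervals in $C$. The key-interval graph is the directed multigraph with vertex set $\mathcal K$ whose edges are all horizontally monotone interval chains $(I_0,\dots,I_m)$ with $I_0,I_m\in\mathcal K$ and all intermediate intervals non-key (directed from $I_0$ to $I_m$; distinct chains are distinct edges). $\mathcal{E}_{\mathrm{out}}(K)$ is the set of edges with $I_0=K$.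 **Transition vertices.** Let $K\in\mathcal K$ and let $I_1,\dots,I_q$ be its direct neighbors on one side, sorted by start coordinate. For each consecutive pair $I_i,I_{i+1}$, the gap contains at least one key point $(K.x,y)$ of $K$ with $I_i.y_e<y<I_{i+1}.y_s$; one such key point is stored as the representative of the gap. For two distinct same-side neighbors, named so that $\alpha<\beta$, $K.T$ of the pair is the representative of the gap between $I_\alpha$ and $I_{\alpha+1}$. $K.T$ is defined only for two distinct direct neighbors on the same side of $K$. **Algorithm KIA\*.** A nonterminal state $c$ has a key interval $c.K$, an incoming interval $c.N_{\mathrm{in}}\in N_d(c.K)\cup\{\bot\}$ and a waypoint sequence $W(c)=\langle w_1,\dots,w_n\rangle$ of vertices. A terminal state has $c.K=c.N_{\mathrm{in}}=\bot$ and a waypoint sequence ending at $t$. Noninitial states store their parent and the interval chain used to reach them (an initial state stores its initialization chain if $I_s\notin\mathcal K$; a terminal state stores the chain from the last expanded key interval to $I_t$). *Evaluation.* For nonterminal $c$ with $K=c.K$, let $v_{\mathrm{proj}}=(K.x,\max\{K.y_s,\min(w_n.y,K.y_e)\})$, $g(c)=\sum_{i=1}^{n-1}\mathcal C_M(w_i,w_{i+1})+\mathcal C_M(w_n,v_{\mathrm{proj}})$, $h(c)=\mathcal C_M(v_{\mathrm{proj}},t)$. For terminal $c$, $g(c)=\sum_{i=1}^{n-1}\mathcal C_M(w_i,w_{i+1})$, $h(c)=0$. Priority is $f(c)=g(c)+h(c)$. *Initialization.* Let $I_s,I_t$ be the vertical intervals containing $s,t$. If $s,t$ share a non-key context, KIA*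 returns a path constructed between them (vertical segment if $I_s=I_t$; otherwise the crossing-row construction below along $\Gamma_C(I_s,I_t)$) and stops. Otherwise, for $q\in\{s,t\}$ set $\mathcal K_q=\{I_q\}$ if $I_q\in\mathcal K$, else $\mathcal K_q=\mathcal B(C_q)$, where $C_q$ is the non-key component containing $I_q$. If $I_s\in\mathcal K$, insert into the open list the state with $c.K=I_s$, $c.N_{\mathrm{in}}=\bot$, $W(c)=\langle s\rangle$. Otherwise, for each $K\in\mathcal K_s$ insert the state with $c.K=K$, $c.N_{\mathrm{in}}=\operatorname{entry}(\Gamma_{C_s}(I_s,K))$, $W(c)=\langle s\rangle$. *Search.* Repeatedly extract a state of minimum $f$ from the open list. If its last waypoint is $t$ (terminal state), return the path reconstructed from it. Otherwise expand it. If the open list becomes empty, report failure. *Expansion of $c$ with $K=c.K$.* If $K\notin\mathcal K_t$: for each $\Gamma=(I_0,\dots,I_m)\in\mathcal E_{\mathrm{out}}(K)$ there is a candidate $c'$ with $c'.K=I_m$, $c'.N_{\mathrm{in}}=\operatorname{entry}(\Gamma)$, and $N_{\mathrm{out}}=\operatorname{exit}(\Gamma)$. If $K\in\mathcal K_t$: there is a single terminal candidate $c'$, with $N_{\mathrm{out}}=\bot$ if $I_t=K$ and $N_{\mathrm{out}}=\operatorname{exit}(\Gamma_{C_t}(K,I_t))$ otherwise. A candidate is discarded if $c.N_{\mathrm{in}}\ne\bot$ and $N_{\mathrm{out}}=c.N_{\mathrm{in}}$. Otherwise set $W(c')=W(c)$ with last element $w_n$, and apply the first applicable rule: (1) if $K.T(c.N_{\mathrm{in}},N_{\mathrm{out}})$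 is defined, append it; (2) else if $K.\mathrm{up}$ exists and $w_n.y>K.\mathrm{up}.y$, append $K.\mathrm{up}$; (3) else if $K.\mathrm{down}$ exists and $w_n.y<K.\mathrm{down}.y$, append $K.\mathrm{down}$. Finally, if $K\in\mathcal K_t$, append $t$. Terminal successors are inserted directly in the open list; nonterminal successors are inserted unless dominated. *Dominance.* For nonterminal states $c_1,c_2$ with the same key interval and projected rows $y_1,y_2$ (the $y$-coordinates of their $v_{\mathrm{proj}}$), $c_1$ dominates $c_2$ if $g(c_1)+|y_1-y_2|\le g(c_2)$. A new nonterminal state is compared with all states retained so far for the same key interval; it is discarded if dominated by one of them; otherwise it is retained and any existing states it dominates are removed. *Path construction.* From the terminal state with waypoints $\langle w_1,\dots,w_n\rangle$ ($w_1=s$, $w_n=t$), each consecutive pair is joined by a grid segment and these are concatenated: the vertical segment if both lie in the same vertical interval; else, if they share a non-key context $C$, the crossing-row construction along $\Gamma_C$ between their intervals; else the crossing-row construction along the concatenated interval chains recorded on the search branch between them. Crossing-row construction along a horizontally monotone chain $(I_0,\dots,I_m)$ from $a\in I_0$ to $b\in I_m$: with $\ell_i=\max(I_i.y_s,I_{i+1}.y_s)$, $u_i=\min(I_i.y_e,I_{i+1}.y_e)$, set $r_0=a.y$ and $r_{i+1}=\max\{r_i,\ell_i\}$ if $a.y\le b.y$ (symmetrically $r_{i+1}=\min\{r_i,u_i\}$ if $a.y>b.y$); move vertically in $I_i$ from row $r_i$ to row $r_{i+1}$, then horizontally into $I_{i+1}$; finally move vertically in $I_m$ to $b$. *)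

(* Defs.v *)
From Stdlib Require Export ZArith List Sorted Relations.
Export ListNotations.
Open Scope Z_scope.

(** * Grid graphs *)

(* A cell is (x, y), with x growing to the right and y growing downwards. *)
Definition cell : Type := (Z * Z)%type.

(* The set of traversable cells. *)
Definition grid : Type := cell -> bool.

Definition in_grid (M N : nat) (V : grid) : Prop :=
  forall x y, V (x, y) = true -> 0 <= x < Z.of_nat M /\ 0 <= y < Z.of_nat N.

Definition manhattan (a b : cell) : Z :=
  Z.abs (fst a - fst b) + Z.abs (snd a - snd b).

(* For integer cells, |x1 - x2| + |y1 - y2| = 1. *)
Definition adjacent (a b : cell) : Prop := manhattan a b = 1.

(* [Sorted adjacent p] says that consecutive elements of p are adjacent. *)
Definition valid_path (V : grid) (s t : cell) (p : list cell) : Prop :=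
  (exists q, p = s :: q) /\ (exists q, p = q ++ [t]) /\
  Forall (fun v => V v = true) p /\ Sorted adjacent p.

Definition transpose_cell (v : cell) : cell := (snd v, fst v).
Definition transpose (V : grid) : grid := fun v => V (transpose_cell v).

(** * Vertical intervals *)

Record interval : Type := Interval { col : Z; ys : Z; ye : Z }.

Definition interval_eq_dec (I J : interval) : {I = J} + {I <> J}.
Proof. decide equality; apply Z.eq_dec. Defined.

Definition is_interval (V : grid) (I : interval) : Prop :=
  ys I <= ye I /\
  (forall y, ys I <= y <= ye I -> V (col I, y) = true) /\
  V (col I, ys I - 1) = false /\ V (col I, ye I + 1) = false.

Definition in_interval (v : cell) (I : interval) : Prop :=
  fst v = col I /\ ys I <= snd v <= ye I.

Definition start_vertex (I : interval) : cell := (col I, ys I).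
Definition end_vertex (I : interval) : cell := (col I, ye I).

Definition neighbor (V : grid) (I J : interval) : Prop :=
  is_interval V I /\ is_interval V J /\ Z.abs (col J - col I) = 1 /\
  exists y, ys I <= y <= ye I /\ ys J <= y <= ye J.

(* d = -1 gives the left, d = 1 the right direct neighbors J of I. *)
Definition side_neighbor (V : grid) (d : Z) (I J : interval) : Prop :=
  neighbor V I J /\ col J = col I + d.

Definition min_start (V : grid) (d : Z) (I J : interval) : Prop :=
  side_neighbor V d I J /\ forall J', side_neighbor V d I J' -> ys J <= ys J'.

Definition max_end (V : grid) (d : Z) (I J : interval) : Prop :=
  side_neighbor V d I J /\ forall J', side_neighbor V d I J' -> ye J' <= ye J.

(** * Key points *)

Inductive trend : Type := UP | DOWN | LEVEL.

(* The recursion of the column scan goes to smaller columns, so on a finite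
   grid these least relations are the graphs of the functions T_s and T_e. *)
Inductive start_trend (V : grid) : interval -> trend -> Prop :=
| start_level I : is_interval V I -> (forall J, ~ side_neighbor V (-1) I J) ->
    start_trend V I LEVEL
| start_down I J : min_start V (-1) I J -> ys I - ys J > 0 ->
    start_trend V I DOWN
| start_up I J : min_start V (-1) I J -> ys I - ys J < 0 ->
    start_trend V I UP
| start_inherit I J T : min_start V (-1) I J -> ys I - ys J = 0 ->
    start_trend V J T -> start_trend V I T.

Inductive end_trend (V : grid) : interval -> trend -> Prop :=
| end_level I : is_interval V I -> (forall J, ~ side_neighbor V (-1) I J) ->
    end_trend V I LEVEL
| end_down I J : max_end V (-1) I J -> ye I - ye J > 0 ->
    end_trend V I DOWN
| end_up I J : max_end V (-1) I J -> ye I - ye J < 0 ->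
    end_trend V I UP
| end_inherit I J T : max_end V (-1) I J -> ye I - ye J = 0 ->
    end_trend V J T -> end_trend V I T.

(* The existence of J includes that I has a right direct neighbor. *)
Definition start_labeled (V : grid) (I : interval) : Prop :=
  start_trend V I DOWN /\ exists J, min_start V 1 I J /\ ys J < ys I.

Definition end_labeled (V : grid) (I : interval) : Prop :=
  end_trend V I UP /\ exists J, max_end V 1 I J /\ ye J > ye I.

Definition scan_labeled (V : grid) (v : cell) : Prop :=
  exists I, (start_labeled V I /\ v = start_vertex I) \/
            (end_labeled V I /\ v = end_vertex I).

(* The horizontal scan is the vertical scan of the transposed grid, with
   RIGHT/LEFT in place of DOWN/UP. *)
Definition key_point (V : grid) (v : cell) : Prop :=
  scan_labeled V v \/ scan_labeled (transpose V) (transpose_cell v).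

Definition key (V : grid) (K : interval) : Prop :=
  is_interval V K /\ exists v, in_interval v K /\ key_point V v.

Definition nonkey (V : grid) (I : interval) : Prop :=
  is_interval V I /\ ~ key V I.

(** * Non-key components and interval chains *)

Definition nonkey_neighbor (V : grid) (I J : interval) : Prop :=
  nonkey V I /\ nonkey V J /\ neighbor V I J.

Definition is_component (V : grid) (C : interval -> Prop) : Prop :=
  exists I, nonkey V I /\
    forall J, C J <-> clos_refl_trans interval (nonkey_neighbor V) I J.

Definition boundary (V : grid) (C : interval -> Prop) (K : interval) : Prop :=
  key V K /\ exists I, C I /\ neighbor V I K.

Definition closure (V : grid) (C : interval -> Prop) (I : interval) : Prop :=
  C I \/ boundary V C I.

Definition lies_in_closure (V : grid) (C : interval -> Prop) (v : cell) : Prop :=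
  exists I, is_interval V I /\ in_interval v I /\ closure V C I.

Definition share_context (V : grid) (C : interval -> Prop) (a b : cell) : Prop :=
  is_component V C /\ lies_in_closure V C a /\ lies_in_closure V C b.

Definition chain : Type := list interval.

Definition monotone_chain (V : grid) (G : chain) : Prop :=
  (2 <= length G)%nat /\
  exists d, (d = -1 \/ d = 1) /\ Sorted (side_neighbor V d) G.

Definition chain_exit (G : chain) : option interval := nth_error G 1.
Definition chain_entry (G : chain) : option interval :=
  nth_error G (length G - 2).

(* G is the chain Gamma_C(Ia, Ib). *)
Definition context_chain (V : grid) (C : interval -> Prop) (Ia Ib : interval)
    (G : chain) : Prop :=
  Ia <> Ib /\ closure V C Ia /\ closure V C Ib /\ monotone_chain V G /\
  exists mid, G = Ia :: mid ++ [Ib] /\ Forall C mid.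

(* G is an edge from K to K' of the key-interval graph. *)
Definition key_edge (V : grid) (K K' : interval) (G : chain) : Prop :=
  key V K /\ key V K' /\ monotone_chain V G /\
  exists mid, G = K :: mid ++ [K'] /\ Forall (nonkey V) mid.

(** * Transition vertices *)

Definition consecutive (V : grid) (d : Z) (K I J : interval) : Prop :=
  side_neighbor V d K I /\ side_neighbor V d K J /\ ys I < ys J /\
  forall J', side_neighbor V d K J' -> ~ (ys I < ys J' < ys J).

(* [rep K I J] is the stored key point of K in the gap between the consecutive
   same-side neighbors I and J of K. *)
Definition gap_choice : Type := interval -> interval -> interval -> cell.

Definition valid_gap_choice (V : grid) (rep : gap_choice) : Prop :=
  forall d K I J, key V K -> consecutive V d K I J ->
    key_point V (rep K I J) /\ in_interval (rep K I J) K /\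
    ye I < snd (rep K I J) < ys J.

(* v = K.T(A, B); no such v exists when K.T is undefined, in particular when
   an argument is None. *)
Definition transition (V : grid) (rep : gap_choice) (K : interval)
    (oA oB : option interval) (v : cell) : Prop :=
  exists d A B L J,
    oA = Some A /\ oB = Some B /\ A <> B /\
    side_neighbor V d K A /\ side_neighbor V d K B /\
    ((L = A /\ ys A < ys B) \/ (L = B /\ ys B < ys A)) /\
    consecutive V d K L J /\ v = rep K L J.

(** * Search states *)

(* None stands for the bottom symbol; terminal states have [key_of] = None. *)
Record node : Type := Node {
  key_of : option interval;
  N_in : option interval;
  waypoints : list cell;
  reached_by : chain
}.

Inductive state : Type :=
| Initial (n : node)
| Successor (parent : state) (n : node).

Definition node_of (c : state) : node :=
  match c with Initial n => n | Successor _ n => n end.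

(* The default is never used: waypoint sequences are nonempty. *)
Definition last_waypoint (c : state) : cell :=
  last (waypoints (node_of c)) (0, 0).

Fixpoint waypoint_cost (W : list cell) : Z :=
  match W with
  | a :: ((b :: _) as W') => manhattan a b + waypoint_cost W'
  | _ => 0
  end.

Definition projection (K : interval) (w : cell) : cell :=
  (col K, Z.max (ys K) (Z.min (snd w) (ye K))).

Definition g_value (c : state) : Z :=
  waypoint_cost (waypoints (node_of c)) +
  match key_of (node_of c) with
  | Some K => manhattan (last_waypoint c) (projection K (last_waypoint c))
  | None => 0
  end.

Definition h_value (t : cell) (c : state) : Z :=
  match key_of (node_of c) with
  | Some K => manhattan (projection K (last_waypoint c)) t
  | None => 0
  end.

Definition f_value (t : cell) (c : state) : Z := g_value c + h_value t c.

Definition dominates (c1 c2 : state) : bool :=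
  match key_of (node_of c1), key_of (node_of c2) with
  | Some K1, Some K2 =>
      if interval_eq_dec K1 K2 then
        g_value c1 + Z.abs (snd (projection K1 (last_waypoint c1)) -
                            snd (projection K2 (last_waypoint c2)))
        <=? g_value c2
      else false
  | _, _ => false
  end.

(** * Path construction *)

(* The vertical run in column x from row y1 to row y2, both included. *)
Definition vertical_run (x y1 y2 : Z) : list cell :=
  map (fun k => (x, y1 + Z.sgn (y2 - y1) * Z.of_nat k))
      (seq 0 (S (Z.abs_nat (y2 - y1)))).

(* r is the current row in the first interval of G; [down] tells whether the
   rows are updated by the max-rule (a.y <= b.y) or by the min-rule. *)
Fixpoint crossing_from (down : bool) (r : Z) (G : chain) (yb : Z) : list cell :=
  match G with
  | [] => []
  | I1 :: G' =>
      match G' with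
      | [] => vertical_run (col I1) r yb
      | I2 :: _ =>
          let r' := if down then Z.max r (Z.max (ys I1) (ys I2))
                    else Z.min r (Z.min (ye I1) (ye I2)) in
          vertical_run (col I1) r r' ++ crossing_from down r' G' yb
      end
  end.

Definition crossing_path (G : chain) (a b : cell) : list cell :=
  crossing_from (snd a <=? snd b) (snd a) G (snd b).

(* The grid segment joining a to b; [rec] is the interval chain recorded on the
   search branch between them. Two vertices may share several contexts; any
   of them may be used. *)
Inductive segment (V : grid) (rec : chain) (a b : cell) : list cell -> Prop :=
| segment_vertical I :
    is_interval V I -> in_interval a I -> in_interval b I ->
    segment V rec a b (vertical_run (col I) (snd a) (snd b))
| segment_context Ia Ib C G :
    is_interval V Ia -> in_interval a Ia -> is_interval V Ib -> in_interval b Ib ->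
    Ia <> Ib -> share_context V C a b -> context_chain V C Ia Ib G ->
    segment V rec a b (crossing_path G a b)
| segment_branch Ia Ib :
    is_interval V Ia -> in_interval a Ia -> is_interval V Ib -> in_interval b Ib ->
    Ia <> Ib -> (forall C, ~ share_context V C a b) ->
    segment V rec a b (crossing_path rec a b).

(* Concatenation of the chains recorded on the branch of c; consecutive chains
   share an interval. *)
Fixpoint route (c : state) : chain :=
  match c with
  | Initial n => reached_by n
  | Successor p n => route p ++ tl (reached_by n)
  end.

(* The waypoints of c with their positions in [route c]: s stands at its
   beginning, t at its end, and every other waypoint at the key interval whose
   expansion appended it. *)
Fixpoint placed_waypoints (c : state) : list (cell * nat) :=
  match c with
  | Initial n => map (fun w => (w, 0%nat)) (waypoints n)
  | Successor p n =>
      let new := skipn (length (waypoints (node_of p))) (waypoints n) in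
      let place := map (fun w : cell => (w, (length (route p) - 1)%nat)) in
      placed_waypoints p ++
      match key_of n with
      | Some _ => place new
      | None => place (removelast new) ++
                [(last new (0, 0), (length (route c) - 1)%nat)]
      end
  end.

Definition slice (i j : nat) (G : chain) : chain :=
  firstn (j - i + 1) (skipn i G).

(* The common vertex of two successive segments occurs once in the path. *)
Inductive joined (V : grid) (G : chain) : list (cell * nat) -> list cell -> Prop :=
| joined_single w i : joined V G [(w, i)] [w]
| joined_cons a i b j W seg p :
    segment V (slice i j G) a b seg -> joined V G ((b, j) :: W) p ->
    joined V G ((a, i) :: (b, j) :: W) (seg ++ tl p).

Definition reconstructs (V : grid) (c : state) (p : list cell) : Prop :=
  joined V (route c) (placed_waypoints c) p.

(** * Expansion *)

(* The waypoints added at K before t is possibly added; w is the last waypoint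
   so far. [end_labeled V K] says that K.up exists (and is the end vertex of K),
   [start_labeled V K] that K.down exists (and is the start vertex of K). *)
Inductive waypoint_rule (V : grid) (rep : gap_choice) (K : interval)
    (Nin Nout : option interval) (w : cell) : list cell -> Prop :=
| rule_transition v :
    transition V rep K Nin Nout v ->
    waypoint_rule V rep K Nin Nout w [v]
| rule_up :
    (forall v, ~ transition V rep K Nin Nout v) ->
    end_labeled V K /\ snd w > ye K ->
    waypoint_rule V rep K Nin Nout w [end_vertex K]
| rule_down :
    (forall v, ~ transition V rep K Nin Nout v) ->
    ~ (end_labeled V K /\ snd w > ye K) ->
    start_labeled V K /\ snd w < ys K ->
    waypoint_rule V rep K Nin Nout w [start_vertex K]
| rule_none :
    (forall v, ~ transition V rep K Nin Nout v) ->
    ~ (end_labeled V K /\ snd w > ye K) ->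
    ~ (start_labeled V K /\ snd w < ys K) ->
    waypoint_rule V rep K Nin Nout w [].

(* The (empty or one-element) list of successors obtained from one candidate:
   [K'] and [Nin'] are the key interval and incoming interval of the candidate,
   [G] the chain reaching it, and [final] is [t] for a terminal candidate. *)
Inductive candidate (V : grid) (rep : gap_choice) (c : state) (K : interval)
    (Nout K' Nin' : option interval) (G : chain) (final : list cell) :
    list state -> Prop :=
| candidate_discarded :
    N_in (node_of c) <> None -> Nout = N_in (node_of c) ->
    candidate V rep c K Nout K' Nin' G final []
| candidate_kept ext :
    ~ (N_in (node_of c) <> None /\ Nout = N_in (node_of c)) ->
    waypoint_rule V rep K (N_in (node_of c)) Nout (last_waypoint c) ext ->
    candidate V rep c K Nout K' Nin' G final
      [Successor c (Node K' Nin' (waypoints (node_of c) ++ ext ++ final) G)].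

Definition query_keys (V : grid) (q : cell) (K : interval) : Prop :=
  exists I, is_interval V I /\ in_interval q I /\
    ((key V I /\ K = I) \/
     (nonkey V I /\ exists C, is_component V C /\ C I /\ boundary V C K)).

(* [succs] lists the successors of c in the order in which they are inserted;
   that order is arbitrary. *)
Inductive expands (V : grid) (rep : gap_choice) (t : cell) (c : state) :
    list state -> Prop :=
| expands_edges K Gs ls :
    key_of (node_of c) = Some K -> ~ query_keys V t K ->
    NoDup Gs -> (forall G, In G Gs <-> exists K', key_edge V K K' G) ->
    Forall2 (fun G l => exists K', key_edge V K K' G /\
               candidate V rep c K (chain_exit G) (Some K') (chain_entry G) G [] l)
            Gs ls ->
    expands V rep t c (concat ls)
| expands_at_target K l :
    key_of (node_of c) = Some K -> query_keys V t K -> in_interval t K ->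
    candidate V rep c K None None None [K] [t] l ->
    expands V rep t c l
| expands_to_target K It C G l :
    key_of (node_of c) = Some K -> query_keys V t K ->
    is_interval V It -> in_interval t It -> It <> K ->
    is_component V C -> C It -> context_chain V C K It G ->
    candidate V rep c K (chain_exit G) None None G [t] l ->
    expands V rep t c l.

(** * Runs of the algorithm *)

(* The start interval itself serves as trivial initialization chain when it is
   a key interval. *)
Definition initial_states (V : grid) (s : cell) (l : list state) : Prop :=
  exists Is, is_interval V Is /\ in_interval s Is /\
    ((key V Is /\ l = [Initial (Node (Some Is) None [s] [Is])]) \/
     (nonkey V Is /\ exists C Ks,
        is_component V C /\ C Is /\
        NoDup Ks /\ (forall K, In K Ks <-> boundary V C K) /\
        Forall2 (fun K c => exists G, context_chain V C Is K G /\
                   c = Initial (Node (Some K) (chain_entry G) [s] G))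
                Ks l)).

(* Insertion into the pair (open list, retained states). Dominated states are
   removed from both components. *)
Definition insert_state (OR : list state * list state) (c : state) :
    list state * list state :=
  let '(op, ret) := OR in
  match key_of (node_of c) with
  | None => (op ++ [c], ret)
  | Some _ =>
      if existsb (fun c' => dominates c' c) ret then (op, ret)
      else
        let keep := filter (fun c' => negb (dominates c c')) in
        (keep op ++ [c], keep ret ++ [c])
  end.

Inductive config : Type :=
| Start
| Ready (rep : gap_choice)
| Searching (rep : gap_choice) (op ret : list state)
| Returned (p : list cell)
| Failed.

Definition extracts_min (t : cell) (op : list state) (c : state)
    (rest : list state) : Prop :=
  (exists l1 l2, op = l1 ++ c :: l2 /\ rest = l1 ++ l2) /\
  forall c', In c' op -> f_value t c <= f_value t c'.

(* Every choice left open by the algorithm (gap representatives, shared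
   context, insertion order, ties in the open list) is nondeterministic. *)
Inductive step (V : grid) (s t : cell) : config -> config -> Prop :=
| step_preprocess rep :
    valid_gap_choice V rep -> step V s t Start (Ready rep)
| step_direct rep C p :
    share_context V C s t -> segment V [] s t p ->
    step V s t (Ready rep) (Returned p)
| step_initialize rep l :
    (forall C, ~ share_context V C s t) -> initial_states V s l ->
    step V s t (Ready rep) (Searching rep l l)
| step_empty rep ret :
    step V s t (Searching rep [] ret) Failed
| step_return rep op ret c rest p :
    extracts_min t op c rest -> last_waypoint c = t -> reconstructs V c p ->
    step V s t (Searching rep op ret) (Returned p)
| step_expand rep op ret c rest succs op' ret' :
    extracts_min t op c rest -> last_waypoint c <> t ->
    expands V rep t c succs ->
    fold_left insert_state succs (rest, ret) = (op', ret') ->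
    step V s t (Searching rep op ret) (Searching rep op' ret').

(* Every maximal run of the transition relation R from x is finite up to, and
   reaches, a configuration satisfying Q: there is no divergence and no
   deadlock before Q holds. *)
Inductive inevitably {A : Type} (R : A -> A -> Prop) (Q : A -> Prop) : A -> Prop :=
| inevitably_now x : Q x -> inevitably R Q x
| inevitably_next x :
    (exists y, R x y) -> (forall y, R x y -> inevitably R Q y) ->
    inevitably R Q x.

(* Main.v *)
Require Import Defs.
From Stdlib Require Import Lia Classical ClassicalEpsilon.

(* Soundness. Along a horizontally monotone chain, a strict peak of the start
   rows is a start vertex labeled as a key point, and a strict valley of the end
   rows an end vertex so labeled. Non-key intervals carry no label, and a key
   interval passed without appending a waypoint has its labels on the harmless
   side of the last waypoint; hence no such peak or valley obstructs the
   crossing rows. A route turns around only where a transition vertex is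
   appended, so it is monotone between consecutive waypoints.

   Termination. For each row of each key interval, consider the least cost
   g + |row difference| over the retained states. Domination preserves these
   minima (triangle inequality), and an undominated state lowers the one at its
   own row.

   Completeness. Dominance compares states with different incoming intervals,
   but the only exit a state refuses leads back to the key interval it came from
   (or to an initial one). So if no terminal state is ever generated, the visited
   key intervals are closed under the edges of the key-interval graph, and the
   cells around them include everything connected to s. *)

(** Gaps between same-side neighbors must first be shown to contain key points. This makes the
    stored representatives exist, and it shows that a non-key interval has at most one neighbor per
    side; joining intervals inside a component and retracing edges both rest on the latter. Trends
    come from a scan in one direction only, so chains running left are treated by reversal. A
    terminal candidate could be refused too, namely if its exit is the incoming interval. That exit
    lies in the component of [t], so it suffices that no state has its incoming interval there:
    initial states do not, since [s] and [t] share no context, and successors do not, since a key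
    interval bordering that component is never expanded along edges. The minima over retained states
    are infinite until a state for that key interval appears, so their sum alone need not decrease;
    the number of infinite ones is compared before it. Expansions that retain nothing are covered by
    a third component, the weight of the open list. *)

(** * Sorted lists, minima and filtering *)

Lemma Sorted_glue {A} (R : A -> A -> Prop) l1 x l2 :
  Sorted R (l1 ++ x :: l2) <-> Sorted R (l1 ++ [x]) /\ Sorted R (x :: l2).
Proof.
  induction l1 as [|a l1 IH]; simpl.
  - split; [intros H; split; auto | tauto].
  - destruct l1 as [|b l1]; simpl in *.
    + split.
      * intros H. inversion H as [|? ? Ha Hb]; subst. inversion Hb; subst. auto.
      * intros [H1 H2]. inversion H1 as [|? ? Hc Hd]; subst.
        inversion Hd; subst. auto.
    + split.
      * intros H. inversion H as [|? ? Ha Hb]; subst. inversion Hb; subst.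
        apply IH in Ha as [H3 H4]. auto.
      * intros [H1 H2]. inversion H1 as [|? ? Hc Hd]; subst.
        inversion Hd; subst. constructor; [apply IH; auto | auto].
Qed.

Lemma Sorted_pairs {A} (R : A -> A -> Prop) l :
  Sorted R l <-> forall l1 x y l2, l = l1 ++ x :: y :: l2 -> R x y.
Proof.
  split.
  - intros H l1 x y l2 ->. apply Sorted_glue in H as [_ H].
    inversion H as [|? ? _ H1]; subst. inversion H1; auto.
  - induction l as [|a l IH]; intros H; constructor.
    + apply IH. intros l1 x y l2 ->. apply (H (a :: l1) x y l2 eq_refl).
    + destruct l as [|b l]; constructor. apply (H [] a b l eq_refl).
Qed.

Lemma Sorted_rev {A} (R R' : A -> A -> Prop) l :
  (forall x y, R x y -> R' y x) -> Sorted R l -> Sorted R' (rev l).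
Proof.
  intros HR H. apply Sorted_pairs. intros l1 x y l2 E.
  apply HR. apply (proj1 (Sorted_pairs R l) H (rev l2) y x (rev l1)).
  rewrite <- (rev_involutive l), E, rev_app_distr. simpl.
  now rewrite <- !app_assoc.
Qed.

(** Strong induction on the distance to the lower bound [b]. Interval ends, extremal neighbors, the
    next neighbor after a gap and the state of least [f] are all obtained from it; maxima use the
    negated function. *)
Lemma argmin {A} (f : A -> Z) (P : A -> Prop) b :
  (exists a, P a) -> (forall a, P a -> b <= f a) ->
  exists a, P a /\ forall a', P a' -> f a <= f a'.
Proof.
  intros [a Ha] Hb. remember (Z.to_nat (f a - b)) as n eqn:En.
  revert a Ha En. induction n as [n IH] using lt_wf_ind. intros a Ha ->.
  destruct (classic (exists a', P a' /\ f a' < f a)) as [[a' [H1 H2]]|H].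
  - apply (IH (Z.to_nat (f a' - b))) with (a := a'); auto.
    specialize (Hb a' H1). lia.
  - exists a. split; auto. intros a' H'. apply Z.nlt_ge. eauto.
Qed.

Lemma filter_Prop {A} (P : A -> Prop) (l : list A) :
  NoDup l -> exists l', NoDup l' /\ forall x, In x l' <-> In x l /\ P x.
Proof.
  intros H. exists (filter (fun x => if excluded_middle_informative (P x) then true else false) l).
  split; [now apply NoDup_filter|].
  intros x. rewrite filter_In. destruct (excluded_middle_informative (P x)); intuition congruence.
Qed.

(** * Walks in a bounded grid *)

(** The dimensions are hidden because transposition exchanges them and the horizontal scan needs the
    same hypothesis. *)
Definition bounded (V : grid) : Prop := exists M N, in_grid M N V.

Lemma bounded_transpose V : bounded V -> bounded (transpose V).
Proof.
  intros (M & N & H). exists N, M. intros x y E.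
  destruct (H y x E). auto.
Qed.

(** Inductive form of [valid_path] with both end points as indices, so that paths can be
    concatenated by induction. *)
Inductive walk (V : grid) : cell -> cell -> list cell -> Prop :=
| walk_one v : V v = true -> walk V v v [v]
| walk_cons v u t p : V v = true -> adjacent v u -> walk V u t p ->
    walk V v t (v :: p).

Lemma walk_head V a b p : walk V a b p -> V a = true /\ exists q, p = a :: q.
Proof. intros H; inversion H; subst; eauto. Qed.

Lemma walk_valid V a b p : walk V a b p <-> valid_path V a b p.
Proof.
  split.
  - induction 1 as [v Hv | v u t p Hv Ha Hw (_ & [q Hq] & H3 & H4)].
    + repeat split; [exists []; auto | exists []; auto | auto | auto].
    + repeat split; [exists p; auto | exists (v :: q); subst; auto | auto | ].
      apply walk_head in Hw as [_ [q' ->]]. auto.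
  - intros ([q ->] & [q' E] & H3 & H4). revert a q' E H3 H4.
    induction q as [|u q IH]; intros a q' E H3 H4.
    + destruct q' as [|? [|? ?]]; simpl in E; try discriminate.
      injection E as <-. constructor. now inversion H3.
    + destruct q' as [|a' q']; simpl in E; [discriminate|].
      injection E as <- E. inversion H3; subst. inversion H4 as [|? ? Ha Hb]; subst.
      inversion Hb; subst. econstructor; eauto.
Qed.

Lemma walk_app V a b c d p q :
  walk V a b p -> adjacent b c -> walk V c d q -> walk V a d (p ++ q).
Proof. induction 1; intros; simpl; econstructor; eauto. Qed.

Lemma walk_join V a b c p q :
  walk V a b p -> walk V b c q -> walk V a c (p ++ tl q).
Proof.
  induction 1 as [v Hv | v u t p Hv Ha Hw IH]; intros Hq; simpl.
  - destruct (walk_head _ _ _ _ Hq) as [_ [q' ->]]. exact Hq.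
  - econstructor; eauto.
Qed.

Lemma vertical_run_walk V x y1 y2 :
  (forall y, Z.min y1 y2 <= y <= Z.max y1 y2 -> V (x, y) = true) ->
  walk V (x, y1) (x, y2) (vertical_run x y1 y2).
Proof.
  intros H. unfold vertical_run.
  set (n := Z.abs_nat (y2 - y1)). set (g := Z.sgn (y2 - y1)).
  assert (Hg : y2 = y1 + g * Z.of_nat n) by lia.
  (* Generalized to runs that start at offset [j] with [m] steps left, so that the induction can
     move the starting point. *)
  assert (Hstep : forall m j, (j + m = n)%nat ->
    walk V (x, y1 + g * Z.of_nat j) (x, y2)
      (map (fun k => (x, y1 + g * Z.of_nat k)) (seq j (S m)))).
  { induction m as [|m IH]; intros j E; simpl.
    - replace j with n by lia. rewrite <- Hg. constructor. apply H. lia.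
    - econstructor; [apply H; nia | | apply (IH (S j)); lia].
      unfold adjacent, manhattan; simpl. nia. }
  specialize (Hstep n 0%nat eq_refl).
  replace (y1 + g * Z.of_nat 0) with y1 in Hstep by lia. exact Hstep.
Qed.

(** * Vertical intervals and their direct neighbors *)

Lemma interval_cell V I y : is_interval V I -> ys I <= y <= ye I -> V (col I, y) = true.
Proof. intros (_ & H & _); auto. Qed.

Lemma in_interval_cell V I v : is_interval V I -> in_interval v I -> V v = true.
Proof.
  intros HI [H1 H2]. destruct v as [x y]; simpl in *; subst.
  now apply interval_cell.
Qed.

(** The run through the cell is bounded by the smallest and the largest row connected to it inside
    the column. If the cell just beyond an end were traversable, that end would not be extremal. *)
Lemma interval_exists V v : bounded V -> V v = true ->
  exists I, is_interval V I /\ in_interval v I.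
Proof.
  intros (M & N & Hg) Hv. destruct v as [x y].
  destruct (argmin (fun z => z) (fun z => z <= y /\ forall w, z <= w <= y -> V (x, w) = true) 0)
    as (a & [Ha1 Ha2] & Ha3).
  { exists y. split; [lia|]. intros w Hw. now replace w with y by lia. }
  { intros z [Hz1 Hz2]. specialize (Hz2 z ltac:(lia)). apply Hg in Hz2. cbv beta. lia. }
  destruct (argmin (fun z => - z) (fun z => y <= z /\ forall w, y <= w <= z -> V (x, w) = true) (- Z.of_nat N))
    as (b & [Hb1 Hb2] & Hb3).
  { exists y. split; [lia|]. intros w Hw. now replace w with y by lia. }
  { intros z [Hz1 Hz2]. specialize (Hz2 z ltac:(lia)). apply Hg in Hz2. cbv beta. lia. }
  exists (Interval x a b). split; [|split; simpl; auto].
  unfold is_interval; simpl. split; [lia|]. split; [|split].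
  - intros w Hw. destruct (Z.le_gt_cases w y); [apply Ha2 | apply Hb2]; lia.
  - destruct (V (x, a - 1)) eqn:E; auto. exfalso.
    enough (a <= a - 1) by lia. apply Ha3. split; [lia|]. intros w Hw.
    destruct (Z.eq_dec w (a - 1)) as [->|]; auto. apply Ha2; lia.
  - destruct (V (x, b + 1)) eqn:E; auto. exfalso.
    enough (- b <= - (b + 1)) by lia. apply Hb3. split; [lia|]. intros w Hw.
    destruct (Z.eq_dec w (b + 1)) as [->|]; auto. apply Hb2; lia.
Qed.

Lemma interval_unique V I J v :
  is_interval V I -> is_interval V J -> in_interval v I -> in_interval v J -> I = J.
Proof.
  intros (I1 & I2 & I3 & I4) (J1 & J2 & J3 & J4) [E1 E2] [E3 E4].
  destruct I as [x a b], J as [x' a' b'], v as [x0 y]; simpl in *. subst x x'.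
  assert (a = a').
  { destruct (Z.lt_trichotomy a a') as [H|[H|H]]; auto.
    - rewrite I2 in J3 by lia. discriminate.
    - rewrite J2 in I3 by lia. discriminate. }
  assert (b = b').
  { destruct (Z.lt_trichotomy b b') as [H'|[H'|H']]; auto.
    - rewrite J2 in I4 by lia. discriminate.
    - rewrite I2 in J4 by lia. discriminate. }
  now subst.
Qed.

Lemma interval_row_unique V I J y :
  is_interval V I -> is_interval V J -> col I = col J ->
  ys I <= y <= ye I -> ys J <= y <= ye J -> I = J.
Proof.
  intros HI HJ E H1 H2. apply (interval_unique V I J (col I, y)); auto; split; auto.
Qed.

(** The cell just after [I] is blocked, hence the extra [+ 1]: were it the first cell of [J], it
    would be traversable. *)
Lemma interval_order V I J :
  is_interval V I -> is_interval V J -> col I = col J -> ys I < ys J -> ye I + 1 < ys J.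
Proof.
  intros HI HJ E H. destruct (Z.lt_ge_cases (ye I + 1) (ys J)) as [|H']; auto.
  exfalso. pose proof HJ as (J1 & J2 & _). destruct (Z.eq_dec (ye I + 1) (ys J)) as [E'|N].
  - destruct HI as (_ & _ & _ & HI). rewrite E, E', J2 in HI by lia. discriminate.
  - assert (I = J) by (apply (interval_row_unique V I J (ys J)); auto; lia).
    subst. lia.
Qed.

Lemma interval_bounds V M N I : in_grid M N V -> is_interval V I ->
  0 <= col I < Z.of_nat M /\ 0 <= ys I <= ye I /\ ye I < Z.of_nat N.
Proof.
  intros Hg (H1 & H2 & _).
  destruct (Hg _ _ (H2 (ys I) ltac:(lia))). destruct (Hg _ _ (H2 (ye I) ltac:(lia))). lia.
Qed.

Lemma intervals_finite V : bounded V ->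
  exists l, NoDup l /\ forall I, In I l <-> is_interval V I.
Proof.
  intros (M & N & Hg).
  set (range := fun n => map Z.of_nat (seq 0 n)).
  assert (Hr : forall n z, 0 <= z < Z.of_nat n -> In z (range n)).
  { intros n z Hz. unfold range. apply in_map_iff. exists (Z.to_nat z).
    split; [lia|]. apply in_seq. lia. }
  set (all := map (fun q => Interval (fst q) (fst (snd q)) (snd (snd q)))
                (list_prod (range M) (list_prod (range N) (range N)))).
  destruct (filter_Prop (is_interval V) (nodup interval_eq_dec all)) as (l & H1 & H2);
    [apply NoDup_nodup|].
  exists l. split; auto. intros I. rewrite H2, nodup_In. split; [tauto|].
  intros HI. split; auto. unfold all. apply in_map_iff.
  pose proof (interval_bounds _ _ _ _ Hg HI).
  exists (col I, (ys I, ye I)). destruct I; simpl in *. split; auto.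
  repeat apply in_prod; apply Hr; lia.
Qed.

Lemma neighbor_sym V I J : neighbor V I J -> neighbor V J I.
Proof.
  intros (H1 & H2 & H3 & y & H4 & H5). repeat split; try apply H1; try apply H2; [lia|].
  exists y; auto.
Qed.

Lemma side_neighbor_sym V d I J : side_neighbor V d I J -> side_neighbor V (- d) J I.
Proof. intros [H1 H2]. split; [now apply neighbor_sym | lia]. Qed.

(** The equation on [e] keeps sides as the literals -1 and 1 instead of negations of them. *)
Lemma side_neighbor_flip V d e I J : e = - d -> side_neighbor V d I J -> side_neighbor V e J I.
Proof. intros ->. apply side_neighbor_sym. Qed.

Lemma neighbor_side V I J : neighbor V I J -> exists d, (d = -1 \/ d = 1) /\ side_neighbor V d I J.
Proof.
  intros H. exists (col J - col I). split; [|split; auto; lia].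
  destruct H as (_ & _ & H & _). lia.
Qed.

Lemma side_neighbor_intro V d I J y : (d = -1 \/ d = 1) ->
  is_interval V I -> is_interval V J -> col J = col I + d ->
  ys I <= y <= ye I -> ys J <= y <= ye J -> side_neighbor V d I J.
Proof.
  intros Hd HI HJ E H1 H2. repeat split; try apply HI; try apply HJ; auto; [lia|].
  exists y; auto.
Qed.

Lemma min_start_exists V d I J : bounded V -> side_neighbor V d I J ->
  exists J', min_start V d I J' /\ ys J' <= ys J.
Proof.
  intros (M & N & Hg) HJ.
  destruct (argmin ys (side_neighbor V d I) 0) as (J' & H1 & H2); eauto.
  - intros K [(_ & HK & _) _]. apply (interval_bounds _ _ _ _ Hg) in HK. cbv beta. lia.
  - exists J'. repeat split; auto; apply H1.
Qed.

Lemma max_end_exists V d I J : bounded V -> side_neighbor V d I J ->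
  exists J', max_end V d I J' /\ ye J <= ye J'.
Proof.
  intros (M & N & Hg) HJ.
  destruct (argmin (fun I => - ye I) (side_neighbor V d I) (- Z.of_nat N)) as (J' & H1 & H2); eauto.
  - intros K [(_ & HK & _) _]. apply (interval_bounds _ _ _ _ Hg) in HK. cbv beta. lia.
  - exists J'. split; [split; auto|].
    + intros K HK. specialize (H2 K HK). simpl in H2. lia.
    + specialize (H2 J HJ). simpl in H2. lia.
Qed.

(** * Gaps between neighbors contain key points *)

(** A traversable cell beside [K] strictly inside the gap would lie in a further neighbor starting
    between [I] and [J], so the whole gap is blocked on that side. *)
Lemma consecutive_gap V d K I J : bounded V -> (d = -1 \/ d = 1) ->
  consecutive V d K I J ->
  ye I + 1 < ys J /\ ys K <= ye I <= ye K /\ ys K <= ys J <= ye K /\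
  V (col K + d, ye I) = true /\ V (col K + d, ys J) = true /\
  forall y, ye I < y < ys J -> V (col K + d, y) = false.
Proof.
  intros Hb Hd (HI & HJ & Hlt & Hno).
  destruct HI as [(HK & HI & _ & y1 & ? & ?) EI], HJ as [(_ & HJ & _ & y2 & ? & ?) EJ].
  assert (Hord : ye I + 1 < ys J) by (apply (interval_order V); auto; lia).
  repeat split; try lia.
  - rewrite <- EI. apply interval_cell; auto; lia.
  - rewrite <- EJ. apply interval_cell; auto; lia.
  - intros y Hy. destruct (V (col K + d, y)) eqn:E; auto. exfalso.
    destruct (interval_exists V _ Hb E) as (L & HL & EL & HLy). simpl in *.
    apply (Hno L).
    + apply side_neighbor_intro with (y := y); auto; lia.
    + split.
      * destruct (Z.lt_ge_cases (ys I) (ys L)) as [|Hge]; auto. exfalso.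
        assert (L = I); [|subst; lia]. destruct (Z.eq_dec (ys L) (ys I)) as [Es|].
        -- apply (interval_row_unique V L I (ys L)); auto; try lia; destruct HI; lia.
        -- enough (ye L + 1 < ys I) by (destruct HI; lia).
           apply (interval_order V); auto; lia.
      * lia.
Qed.

Lemma horizontal_interval V x y : bounded V -> V (x, y) = true ->
  exists H, is_interval (transpose V) H /\ col H = y /\ ys H <= x <= ye H.
Proof.
  intros Hb E.
  destruct (interval_exists (transpose V) (y, x) (bounded_transpose V Hb) E) as (H & H1 & H2 & H3).
  exists H; auto.
Qed.

(** In the gap rows the cell right of [K] is blocked, so the horizontal interval through [K] ends at
    column [col K]. In row [ye I] it reaches further, which gives the first gap row the trend of a
    receding end; the trend is inherited through the gap. In row [ys J] it reaches further again, so
    the last gap row receives the label at its end vertex. *)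
Lemma right_gap_key V K I J : bounded V -> consecutive V 1 K I J ->
  key_point V (col K, ys J - 1).
Proof.
  intros Hb HC. pose proof (bounded_transpose V Hb) as Hb'.
  destruct (consecutive_gap V 1 K I J Hb (or_intror eq_refl) HC) as (H1 & H2 & H3 & HI & HJ & Hgap).
  assert (HK : is_interval V K) by apply HC.
  assert (HVK : forall y, ys K <= y <= ye K -> V (col K, y) = true)
    by (intros; now apply interval_cell).
  set (x := col K) in *.
  (* Induction over the gap rows from top to bottom; the trend [UP] of the transposed grid stands
     for LEFT. *)
  assert (Hrow : forall n, ye I + 1 + Z.of_nat n < ys J ->
    exists H, is_interval (transpose V) H /\ col H = ye I + 1 + Z.of_nat n /\
      ys H <= x /\ ye H = x /\ end_trend (transpose V) H UP).
  { assert (Hend : forall y, ye I < y < ys J -> exists H, is_interval (transpose V) H /\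
        col H = y /\ ys H <= x /\ ye H = x).
    { intros y Hy.
      destruct (horizontal_interval V x y Hb (HVK y ltac:(lia))) as (H & E1 & E2 & E3).
      exists H. repeat split; try apply E1; auto; try lia.
      destruct (Z.eq_dec (ye H) x) as [|Hne]; auto. exfalso.
      pose proof (interval_cell _ _ (x + 1) E1 ltac:(lia)) as Hc.
      unfold transpose, transpose_cell in Hc; simpl in Hc. rewrite E2, Hgap in Hc by lia.
      discriminate. }
    induction n as [|n IH]; intros Hn.
    - destruct (Hend (ye I + 1) ltac:(lia)) as (H & E1 & E2 & E3 & E4).
      exists H. repeat split; try apply E1; try lia.
      destruct (horizontal_interval V x (ye I) Hb (HVK (ye I) ltac:(lia))) as (H' & F1 & F2 & F3).
      assert (ye H' <> x).
      { intros Ex. pose proof F1 as (_ & _ & _ & Hc). unfold transpose, transpose_cell in Hc.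
        simpl in Hc. rewrite F2, Ex, HI in Hc. discriminate. }
      assert (Hs : side_neighbor (transpose V) (-1) H H')
        by (apply side_neighbor_intro with (y := x); auto; lia).
      destruct (max_end_exists _ _ _ _ Hb' Hs) as (M & HM & HM').
      apply end_up with (J := M); auto; lia.
    - destruct (IH ltac:(lia)) as (H' & F1 & F2 & F3 & F4 & F5).
      destruct (Hend (ye I + 1 + Z.of_nat (S n)) ltac:(lia)) as (H & E1 & E2 & E3 & E4).
      exists H. repeat split; try apply E1; try lia.
      assert (Hs : side_neighbor (transpose V) (-1) H H')
        by (apply side_neighbor_intro with (y := x); auto; lia).
      apply end_inherit with (J := H'); auto; [|lia]. split; auto.
      (* A previous-row neighbor ending beyond column [x] would contain [x], hence be [H'], which
         ends at [x]. *)
      intros L HL. destruct (Z.le_gt_cases (ye L) (ye H')) as [|Hgt]; auto. exfalso.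
      assert (L = H'); [|subst; lia].
      destruct HL as [(_ & HL & _ & z & ? & ?) EL].
      apply (interval_row_unique (transpose V) L H' x); auto; lia. }
  destruct (Hrow (Z.to_nat (ys J - 1 - (ye I + 1))) ltac:(lia)) as (H & E1 & E2 & E3 & E4 & E5).
  right. exists H. right. split.
  - split; auto.
    destruct (horizontal_interval V x (ys J) Hb (HVK (ys J) ltac:(lia))) as (H' & F1 & F2 & F3).
    assert (ye H' <> x).
    { intros Ex. pose proof F1 as (_ & _ & _ & Hc). unfold transpose, transpose_cell in Hc.
      simpl in Hc. rewrite F2, Ex, HJ in Hc. discriminate. }
    assert (Hs : side_neighbor (transpose V) 1 H H')
      by (apply side_neighbor_intro with (y := x); auto; lia).
    destruct (max_end_exists _ _ _ _ Hb' Hs) as (M & HM & HM').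
    exists M. split; auto. lia.
  - unfold end_vertex, transpose_cell. simpl. f_equal; lia.
Qed.

(** Mirror image of the right case: in the gap rows the horizontal intervals start at [col K], in
    the rows [ye I] and [ys J] they start further left, and the last gap row is labeled at its start
    vertex. *)
Lemma left_gap_key V K I J : bounded V -> consecutive V (-1) K I J ->
  key_point V (col K, ys J - 1).
Proof.
  intros Hb HC. pose proof (bounded_transpose V Hb) as Hb'.
  destruct (consecutive_gap V (-1) K I J Hb (or_introl eq_refl) HC) as (H1 & H2 & H3 & HI & HJ & Hgap).
  assert (HK : is_interval V K) by apply HC.
  assert (HVK : forall y, ys K <= y <= ye K -> V (col K, y) = true)
    by (intros; now apply interval_cell).
  set (x := col K) in *.
  assert (Hrow : forall n, ye I + 1 + Z.of_nat n < ys J ->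
    exists H, is_interval (transpose V) H /\ col H = ye I + 1 + Z.of_nat n /\
      ys H = x /\ x <= ye H /\ start_trend (transpose V) H DOWN).
  { assert (Hend : forall y, ye I < y < ys J -> exists H, is_interval (transpose V) H /\
        col H = y /\ ys H = x /\ x <= ye H).
    { intros y Hy.
      destruct (horizontal_interval V x y Hb (HVK y ltac:(lia))) as (H & E1 & E2 & E3).
      exists H. repeat split; try apply E1; auto; try lia.
      destruct (Z.eq_dec (ys H) x) as [|Hne]; auto. exfalso.
      pose proof (interval_cell _ _ (x + -1) E1 ltac:(lia)) as Hc.
      unfold transpose, transpose_cell in Hc; cbn [fst snd] in Hc. rewrite E2, Hgap in Hc by lia.
      discriminate. }
    induction n as [|n IH]; intros Hn.
    - destruct (Hend (ye I + 1) ltac:(lia)) as (H & E1 & E2 & E3 & E4).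
      exists H. repeat split; try apply E1; try lia.
      destruct (horizontal_interval V x (ye I) Hb (HVK (ye I) ltac:(lia))) as (H' & F1 & F2 & F3).
      assert (ys H' <> x).
      { intros Ex. pose proof F1 as (_ & _ & Hc & _). unfold transpose, transpose_cell in Hc.
        cbn [fst snd] in Hc. rewrite F2, Ex in Hc.
        change (x - 1) with (x + -1) in Hc. rewrite HI in Hc. discriminate. }
      assert (Hs : side_neighbor (transpose V) (-1) H H')
        by (apply side_neighbor_intro with (y := x); auto; lia).
      destruct (min_start_exists _ _ _ _ Hb' Hs) as (M & HM & HM').
      apply start_down with (J := M); auto; lia.
    - destruct (IH ltac:(lia)) as (H' & F1 & F2 & F3 & F4 & F5).
      destruct (Hend (ye I + 1 + Z.of_nat (S n)) ltac:(lia)) as (H & E1 & E2 & E3 & E4).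
      exists H. repeat split; try apply E1; try lia.
      assert (Hs : side_neighbor (transpose V) (-1) H H')
        by (apply side_neighbor_intro with (y := x); auto; lia).
      apply start_inherit with (J := H'); auto; [|lia]. split; auto.
      intros L HL. destruct (Z.le_gt_cases (ys H') (ys L)) as [|Hgt]; auto. exfalso.
      assert (L = H'); [|subst; lia].
      destruct HL as [(_ & HL & _ & z & ? & ?) EL].
      apply (interval_row_unique (transpose V) L H' x); auto; lia. }
  destruct (Hrow (Z.to_nat (ys J - 1 - (ye I + 1))) ltac:(lia)) as (H & E1 & E2 & E3 & E4 & E5).
  right. exists H. left. split.
  - split; auto.
    destruct (horizontal_interval V x (ys J) Hb (HVK (ys J) ltac:(lia))) as (H' & F1 & F2 & F3).
    assert (ys H' <> x).
    { intros Ex. pose proof F1 as (_ & _ & Hc & _). unfold transpose, transpose_cell in Hc.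
      cbn [fst snd] in Hc. rewrite F2, Ex in Hc.
      change (x - 1) with (x + -1) in Hc. rewrite HJ in Hc. discriminate. }
    assert (Hs : side_neighbor (transpose V) 1 H H')
      by (apply side_neighbor_intro with (y := x); auto; lia).
    destruct (min_start_exists _ _ _ _ Hb' Hs) as (M & HM & HM').
    exists M. split; auto. lia.
  - unfold start_vertex, transpose_cell. simpl. f_equal; lia.
Qed.

Lemma consecutive_side V d K I J : consecutive V d K I J -> d = -1 \/ d = 1.
Proof. intros ([(_ & _ & H & _) E] & _). lia. Qed.

Lemma gap_key V d K I J : bounded V -> consecutive V d K I J ->
  exists v, key_point V v /\ in_interval v K /\ ye I < snd v < ys J.
Proof.
  intros Hb HC. pose proof (consecutive_side _ _ _ _ _ HC) as Hd.
  destruct (consecutive_gap V d K I J Hb Hd HC) as (H1 & H2 & H3 & _).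
  exists (col K, ys J - 1). split; [|split; [split; simpl; lia | simpl; lia]].
  destruct Hd; subst; [eapply left_gap_key | eapply right_gap_key]; eauto.
Qed.

(** The cell [(0, 0)] only witnesses that cells exist, as the choice operator demands; every genuine
    gap contains a key point to choose. *)
Lemma gap_choice_exists V : bounded V -> exists rep, valid_gap_choice V rep.
Proof.
  intros Hb.
  exists (fun K I J => epsilon (inhabits (0, 0)) (fun v =>
    key_point V v /\ in_interval v K /\ ye I < snd v < ys J)).
  intros d K I J _ HC. apply epsilon_spec. eapply gap_key; eauto.
Qed.

(** [J] is the neighbor with least start beyond that of [A]; it need not be [B]. *)
Lemma consecutive_exists V d K A B : bounded V ->
  side_neighbor V d K A -> side_neighbor V d K B -> ys A < ys B ->
  exists J, consecutive V d K A J.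
Proof.
  intros (M & N & Hg) HA HB Hlt.
  destruct (argmin ys (fun J => side_neighbor V d K J /\ ys A < ys J) (ys A)) as (J & [H1 H2] & H3).
  - eauto.
  - intros J [_ H]. cbv beta. lia.
  - exists J. repeat split; try apply HA; try apply H1; auto.
    intros J' HJ' [H4 H5]. specialize (H3 J' (conj HJ' H4)). lia.
Qed.

Lemma same_side_start V d K A B :
  side_neighbor V d K A -> side_neighbor V d K B -> ys A = ys B -> A = B.
Proof.
  intros [(_ & HA & _) EA] [(_ & HB & _) EB] E.
  apply (interval_row_unique V A B (ys A)); auto; destruct HA, HB; lia.
Qed.

Lemma side_neighbor_end V d K A B :
  side_neighbor V d K A -> side_neighbor V d K B -> ye A = ye B -> A = B.
Proof.
  intros [(_ & HA & _) EA] [(_ & HB & _) EB] E.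
  apply (interval_row_unique V A B (ye A)); auto; destruct HA, HB; lia.
Qed.

(** This is the non-branching of non-key components: two neighbors on one side would leave a gap,
    and a gap puts a key point into [I]. *)
Lemma nonkey_side_unique V d I A B : bounded V -> nonkey V I ->
  side_neighbor V d I A -> side_neighbor V d I B -> A = B.
Proof.
  intros Hb [HI Hnk] HA HB.
  assert (Hlt : forall A B, side_neighbor V d I A -> side_neighbor V d I B -> ~ ys A < ys B).
  { clear A B HA HB. intros A B HA HB Hlt.
    destruct (consecutive_exists V d I A B Hb HA HB Hlt) as [J HJ].
    destruct (gap_key V d I A J Hb HJ) as (v & H1 & H2 & _).
    apply Hnk. split; eauto. }
  pose proof (Hlt A B HA HB). pose proof (Hlt B A HB HA).
  apply (same_side_start V d I); auto. lia.
Qed.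

Lemma start_labeled_key V I : is_interval V I -> start_labeled V I -> key V I.
Proof.
  intros HI HL. split; auto. exists (start_vertex I). split.
  - split; simpl; auto. destruct HI; lia.
  - left. exists I. auto.
Qed.

Lemma end_labeled_key V I : is_interval V I -> end_labeled V I -> key V I.
Proof.
  intros HI HL. split; auto. exists (end_vertex I). split.
  - split; simpl; auto. destruct HI; lia.
  - left. exists I. auto.
Qed.

(** * Crossing rows along monotone chains *)

Lemma last_cons {A} (x : A) l d : last (x :: l) d = last l x.
Proof.
  revert x d. induction l as [|y l IH]; intros x d; auto.
  change (last (y :: l) d = last (y :: l) x). now rewrite !IH.
Qed.

(** Once the start rows exceed [y], the trend is [DOWN], either because some left neighbor starts
    earlier or by inheritance along equal starts. The start rows must later fall to at most [y], and
    the interval before the first strict decrease carries the label. It is not the last one, since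
    the label looks at its right neighbor. *)
Lemma peak_rightwards V y : bounded V -> forall G I J,
  Sorted (side_neighbor V 1) (I :: G) ->
  (ys I <= y \/ start_trend V I DOWN) ->
  ys (last G I) <= y -> In J (I :: G) -> y < ys J ->
  exists K, In K (removelast (I :: G)) /\ start_labeled V K /\ y < ys K.
Proof.
  intros Hb. induction G as [|I' G IH]; intros I J HS Hinv Hlast HJ Hy.
  - destruct HJ as [<-|[]]. simpl in Hlast. lia.
  - apply Sorted_inv in HS as [HS Hhd]. apply HdRel_inv in Hhd. rewrite last_cons in Hlast.
    destruct (classic (y < ys I /\ ys I' < ys I)) as [[H1 H2]|Hno].
    + exists I. split; [now left|]. destruct Hinv as [|Hinv]; [lia|].
      destruct (min_start_exists V 1 I I' Hb Hhd) as (M & HM & HM').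
      repeat split; auto. exists M. split; auto. lia.
    + pose proof (side_neighbor_flip V 1 (-1) I I' eq_refl Hhd) as Hs.
      assert (Hinv' : ys I' <= y \/ start_trend V I' DOWN).
      { destruct (Z.le_gt_cases (ys I') y) as [|Hgt]; [now left|]. right.
        destruct (min_start_exists V (-1) I' I Hb Hs) as (M & HM & HM').
        destruct (Z.lt_ge_cases (ys M) (ys I')).
        - apply start_down with (J := M); auto. lia.
        (* Here no left neighbor starts before [I'], and no decrease is allowed from [I] to [I']; so
           the starts agree and the trend of [I] is inherited. *)
        - assert (M = I) by (apply (same_side_start V (-1) I'); [apply HM | auto | lia]).
          subst M. destruct Hinv as [|Hinv]; [lia|].
          apply start_inherit with (J := I); auto. lia. }
      assert (HJ' : exists J', In J' (I' :: G) /\ y < ys J').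
      { destruct HJ as [->|HJ]; [|eauto]. exists I'. split; [now left | lia]. }
      destruct HJ' as (J' & HJ1 & HJ2).
      destruct (IH I' J' HS Hinv') as (K & HK & HK'); auto.
      exists K. split; auto. right. exact HK.
Qed.

(** The same argument for end rows, with [max_end] for [min_start] and [UP] for [DOWN]. *)
Lemma valley_rightwards V y : bounded V -> forall G I J,
  Sorted (side_neighbor V 1) (I :: G) ->
  (y <= ye I \/ end_trend V I UP) ->
  y <= ye (last G I) -> In J (I :: G) -> ye J < y ->
  exists K, In K (removelast (I :: G)) /\ end_labeled V K /\ ye K < y.
Proof.
  intros Hb. induction G as [|I' G IH]; intros I J HS Hinv Hlast HJ Hy.
  - destruct HJ as [<-|[]]. simpl in Hlast. lia.
  - apply Sorted_inv in HS as [HS Hhd]. apply HdRel_inv in Hhd. rewrite last_cons in Hlast.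
    destruct (classic (ye I < y /\ ye I < ye I')) as [[H1 H2]|Hno].
    + exists I. split; [now left|]. destruct Hinv as [|Hinv]; [lia|].
      destruct (max_end_exists V 1 I I' Hb Hhd) as (M & HM & HM').
      repeat split; auto. exists M. split; auto. lia.
    + pose proof (side_neighbor_flip V 1 (-1) I I' eq_refl Hhd) as Hs.
      assert (Hinv' : y <= ye I' \/ end_trend V I' UP).
      { destruct (Z.le_gt_cases y (ye I')) as [|Hgt]; [now left|]. right.
        destruct (max_end_exists V (-1) I' I Hb Hs) as (M & HM & HM').
        destruct (Z.lt_ge_cases (ye I') (ye M)).
        - apply end_up with (J := M); auto. lia.
        - assert (M = I) by (apply (side_neighbor_end V (-1) I'); [apply HM | auto | lia]).
          subst M. destruct Hinv as [|Hinv]; [lia|].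
          apply end_inherit with (J := I); auto. lia. }
      assert (HJ' : exists J', In J' (I' :: G) /\ ye J' < y).
      { destruct HJ as [->|HJ]; [|eauto]. exists I'. split; [now left | lia]. }
      destruct HJ' as (J' & HJ1 & HJ2).
      destruct (IH I' J' HS Hinv') as (K & HK & HK'); auto.
      exists K. split; auto. right. exact HK.
Qed.

Lemma Sorted_side_rev V d e G : e = - d ->
  Sorted (side_neighbor V d) G -> Sorted (side_neighbor V e) (rev G).
Proof. intros ->. apply Sorted_rev. apply side_neighbor_sym. Qed.

Lemma rev_ends {A} (a b : A) mid : rev (a :: mid ++ [b]) = b :: rev mid ++ [a].
Proof. simpl. now rewrite rev_app_distr. Qed.

(** Peaks are insensitive to the direction of the chain, so a leftward chain is reversed to match
    the direction of the scan. The first interval cannot be the labeled one, since it starts at a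
    row at most [y]. *)
Lemma peak V d I0 mid Im J y : bounded V -> (d = -1 \/ d = 1) ->
  Sorted (side_neighbor V d) (I0 :: mid ++ [Im]) ->
  ys I0 <= y -> ys Im <= y -> In J mid -> y < ys J ->
  exists K, In K mid /\ start_labeled V K /\ y < ys K.
Proof.
  intros Hb Hd HS H0 Hm HJ Hy.
  assert (main : forall I0 mid Im, Sorted (side_neighbor V 1) (I0 :: mid ++ [Im]) ->
    ys I0 <= y -> ys Im <= y -> In J mid ->
    exists K, In K mid /\ start_labeled V K /\ y < ys K).
  { clear - Hb Hy. intros I0 mid Im HS H0 Hm HJ.
    destruct (peak_rightwards V y Hb (mid ++ [Im]) I0 J HS) as (K & HK & HK1 & HK2); auto.
    - rewrite last_last. auto.
    - right. apply in_app_iff. auto.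
    - change (I0 :: mid ++ [Im]) with ((I0 :: mid) ++ [Im]) in HK.
      rewrite removelast_last in HK. destruct HK as [<-|HK]; [lia|]. eauto. }
  destruct Hd as [-> | ->]; [|eauto].
  apply (Sorted_side_rev V (-1) 1) in HS; auto. rewrite rev_ends in HS.
  destruct (main _ _ _ HS) as (K & HK & HK'); auto.
  - now apply in_rev in HJ.
  - exists K. split; auto. now apply in_rev.
Qed.

Lemma valley V d I0 mid Im J y : bounded V -> (d = -1 \/ d = 1) ->
  Sorted (side_neighbor V d) (I0 :: mid ++ [Im]) ->
  y <= ye I0 -> y <= ye Im -> In J mid -> ye J < y ->
  exists K, In K mid /\ end_labeled V K /\ ye K < y.
Proof.
  intros Hb Hd HS H0 Hm HJ Hy.
  assert (main : forall I0 mid Im, Sorted (side_neighbor V 1) (I0 :: mid ++ [Im]) ->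
    y <= ye I0 -> y <= ye Im -> In J mid ->
    exists K, In K mid /\ end_labeled V K /\ ye K < y).
  { clear - Hb Hy. intros I0 mid Im HS H0 Hm HJ.
    destruct (valley_rightwards V y Hb (mid ++ [Im]) I0 J HS) as (K & HK & HK1 & HK2); auto.
    - rewrite last_last. auto.
    - right. apply in_app_iff. auto.
    - change (I0 :: mid ++ [Im]) with ((I0 :: mid) ++ [Im]) in HK.
      rewrite removelast_last in HK. destruct HK as [<-|HK]; [lia|]. eauto. }
  destruct Hd as [-> | ->]; [|eauto].
  apply (Sorted_side_rev V (-1) 1) in HS; auto. rewrite rev_ends in HS.
  destruct (main _ _ _ HS) as (K & HK & HK'); auto.
  - now apply in_rev in HJ.
  - exists K. split; auto. now apply in_rev.
Qed.

(* What is known of a key interval passed without appending a waypoint, w being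
   the last waypoint. *)
Definition clear (V : grid) (w : cell) (I : interval) : Prop :=
  (end_labeled V I -> snd w <= ye I) /\ (start_labeled V I -> ys I <= snd w).

Lemma nonkey_clear V w I : nonkey V I -> clear V w I.
Proof.
  intros [HI Hn]. split; intros HL; exfalso; apply Hn;
    [now apply end_labeled_key | now apply start_labeled_key].
Qed.

(** Under this condition the running maximum of the max-rule collapses: the row at which [I] is left
    is [Z.max r0 (ys J)], whatever intervals came before. [up_ok] does the same for the min-rule. *)
Definition down_ok V d r0 I J := side_neighbor V d I J /\ ys I <= Z.max r0 (ys J).
Definition up_ok V d r0 I J := side_neighbor V d I J /\ Z.min r0 (ye J) <= ye I.

(** Cutting the chain after [J] leaves a chain from [I0] to [J] whose interior lies in [mid]; the
    peak and valley lemmas are applied to this prefix. *)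
Lemma prefix_of_chain {A} (I0 Im : A) mid l1 I J l2 :
  I0 :: mid ++ [Im] = l1 ++ I :: J :: l2 ->
  (l1 = [] /\ I = I0) \/
  exists l1', l1 = I0 :: l1' /\ forall K, In K (l1' ++ [I]) -> In K mid.
Proof.
  destruct l1 as [|a l1]; simpl; intros E; injection E; intros E' E''; subst; auto.
  right. exists l1. split; auto. intros K HK.
  assert (mid = removelast (l1 ++ I :: J :: l2)) by (rewrite <- E'; now rewrite removelast_last).
  subst mid. replace (l1 ++ I :: J :: l2) with ((l1 ++ [I]) ++ (J :: l2)) by now rewrite <- app_assoc.
  rewrite removelast_app by discriminate. apply in_app_iff. auto.
Qed.

(** Otherwise [I] is a peak of the prefix ending at [J], over the level [Z.max (snd a) (ys J)]. This
    yields a start-labeled interval beginning beyond the row of [a], against [clear]. *)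
Lemma chain_down_ok V d I0 mid Im a : bounded V -> (d = -1 \/ d = 1) ->
  Sorted (side_neighbor V d) (I0 :: mid ++ [Im]) -> Forall (clear V a) mid ->
  in_interval a I0 -> Sorted (down_ok V d (snd a)) (I0 :: mid ++ [Im]).
Proof.
  intros Hb Hd HS Hc [_ Ha]. apply Sorted_pairs. intros l1 I J l2 E.
  split; [eapply Sorted_pairs; eauto|].
  destruct (prefix_of_chain _ _ _ _ _ _ _ E) as [[_ ->]|(l1' & -> & Hin)]; [lia|].
  destruct (Z.le_gt_cases (ys I) (Z.max (snd a) (ys J))) as [|Hgt]; auto. exfalso.
  rewrite E in HS. simpl in HS.
  replace (l1' ++ I :: J :: l2) with ((l1' ++ [I]) ++ J :: l2) in HS by now rewrite <- app_assoc.
  apply (Sorted_glue _ (I0 :: l1' ++ [I])) in HS as [HS _].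
  destruct (peak V d I0 (l1' ++ [I]) J I (Z.max (snd a) (ys J))) as (K & H1 & H2 & H3);
    auto; try lia.
  - apply in_app_iff. right. now left.
  - rewrite Forall_forall in Hc. destruct (Hc K (Hin K H1)) as [_ Hk].
    specialize (Hk H2). lia.
Qed.

Lemma chain_up_ok V d I0 mid Im a : bounded V -> (d = -1 \/ d = 1) ->
  Sorted (side_neighbor V d) (I0 :: mid ++ [Im]) -> Forall (clear V a) mid ->
  in_interval a I0 -> Sorted (up_ok V d (snd a)) (I0 :: mid ++ [Im]).
Proof.
  intros Hb Hd HS Hc [_ Ha]. apply Sorted_pairs. intros l1 I J l2 E.
  split; [eapply Sorted_pairs; eauto|].
  destruct (prefix_of_chain _ _ _ _ _ _ _ E) as [[_ ->]|(l1' & -> & Hin)]; [lia|].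
  destruct (Z.le_gt_cases (Z.min (snd a) (ye J)) (ye I)) as [|Hgt]; auto. exfalso.
  rewrite E in HS. simpl in HS.
  replace (l1' ++ I :: J :: l2) with ((l1' ++ [I]) ++ J :: l2) in HS by now rewrite <- app_assoc.
  apply (Sorted_glue _ (I0 :: l1' ++ [I])) in HS as [HS _].
  destruct (valley V d I0 (l1' ++ [I]) J I (Z.min (snd a) (ye J))) as (K & H1 & H2 & H3);
    auto; try lia.
  - apply in_app_iff. right. now left.
  - rewrite Forall_forall in Hc. destruct (Hc K (Hin K H1)) as [Hk _].
    specialize (Hk H2). lia.
Qed.

Lemma side_neighbor_step V d I J y : (d = -1 \/ d = 1) -> side_neighbor V d I J ->
  adjacent (col I, y) (col J, y).
Proof. intros Hd [_ E]. unfold adjacent, manhattan. simpl. lia. Qed.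

Lemma run_in_interval V I y1 y2 : is_interval V I ->
  ys I <= y1 <= ye I -> ys I <= y2 <= ye I ->
  walk V (col I, y1) (col I, y2) (vertical_run (col I) y1 y2).
Proof.
  intros HI H1 H2. apply vertical_run_walk. intros y Hy. apply interval_cell; auto; lia.
Qed.

(** The current row in [I] is [Z.max r0 (ys I)]. It stays inside [I] because no interval of the
    chain ends before [r0]. *)
Lemma crossing_down_walk V d r0 yb : (d = -1 \/ d = 1) -> forall G I,
  Sorted (down_ok V d r0) (I :: G) -> Forall (fun J => r0 <= ye J) (I :: G) ->
  is_interval V I -> ys (last G I) <= yb <= ye (last G I) ->
  walk V (col I, Z.max r0 (ys I)) (col (last G I), yb)
    (crossing_from true (Z.max r0 (ys I)) (I :: G) yb).
Proof.
  intros Hd. induction G as [|J G IH]; intros I HS HF HI Hyb.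
  - cbn in *. apply run_in_interval; auto. inversion HF; subst. destruct HI; lia.
  - apply Sorted_inv in HS as [HS Hhd]. apply HdRel_inv in Hhd as [Hn Hm].
    inversion HF as [|? ? F1 F2]; subst. inversion F2; subst.
    pose proof Hn as [(_ & HJ & _ & y & Hy1 & Hy2) EJ].
    cbn [crossing_from].
    replace (Z.max (Z.max r0 (ys I)) (Z.max (ys I) (ys J))) with (Z.max r0 (ys J)) by lia.
    rewrite last_cons in *.
    eapply walk_app; [| apply (side_neighbor_step V d I J (Z.max r0 (ys J))); auto | apply IH; auto].
    apply run_in_interval; auto; lia.
Qed.

Lemma crossing_up_walk V d r0 yb : (d = -1 \/ d = 1) -> forall G I,
  Sorted (up_ok V d r0) (I :: G) -> Forall (fun J => ys J <= r0) (I :: G) ->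
  is_interval V I -> ys (last G I) <= yb <= ye (last G I) ->
  walk V (col I, Z.min r0 (ye I)) (col (last G I), yb)
    (crossing_from false (Z.min r0 (ye I)) (I :: G) yb).
Proof.
  intros Hd. induction G as [|J G IH]; intros I HS HF HI Hyb.
  - cbn in *. apply run_in_interval; auto. inversion HF; subst. destruct HI; lia.
  - apply Sorted_inv in HS as [HS Hhd]. apply HdRel_inv in Hhd as [Hn Hm].
    inversion HF as [|? ? F1 F2]; subst. inversion F2; subst.
    pose proof Hn as [(_ & HJ & _ & y & Hy1 & Hy2) EJ].
    cbn [crossing_from].
    replace (Z.min (Z.min r0 (ye I)) (Z.min (ye I) (ye J))) with (Z.min r0 (ye J)) by lia.
    rewrite last_cons in *.
    eapply walk_app; [| apply (side_neighbor_step V d I J (Z.min r0 (ye J))); auto | apply IH; auto].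
    apply run_in_interval; auto; lia.
Qed.

(** If [a] is not below [b], both end intervals end at or after the row of [a]. An inner interval
    ending earlier would form a valley and force an end label that [clear] forbids; so the max-rule
    never leaves an interval. The other case exchanges starts and ends. *)
Lemma crossing_path_walk V d I0 mid Im a b : bounded V -> (d = -1 \/ d = 1) ->
  Sorted (side_neighbor V d) (I0 :: mid ++ [Im]) -> Forall (clear V a) mid ->
  in_interval a I0 -> in_interval b Im ->
  walk V a b (crossing_path (I0 :: mid ++ [Im]) a b).
Proof.
  intros Hb Hd HS Hc Ha Hbm. pose proof Hc as Hc'. rewrite Forall_forall in Hc'.
  assert (HI0 : is_interval V I0).
  { apply Sorted_inv in HS as [_ HS]. destruct mid; apply HdRel_inv in HS; apply HS. }
  pose proof Ha as [Ea Ha']. pose proof Hbm as [Eb Hb'].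
  destruct a as [xa ya], b as [xb yb]; cbn [fst snd] in *; subst xa xb.
  unfold crossing_path. cbn [snd]. destruct (Z.leb_spec ya yb) as [Hle|Hgt].
  - pose proof (crossing_down_walk V d ya yb Hd (mid ++ [Im]) I0) as H.
    rewrite last_last in H. replace (Z.max ya (ys I0)) with ya in H by lia.
    apply H; auto.
    + apply (chain_down_ok V d I0 mid Im (col I0, ya)); auto.
    + constructor; [lia|]. apply Forall_app. split; [|constructor; auto; lia].
      apply Forall_forall. intros J HJ. destruct (Z.le_gt_cases ya (ye J)) as [|Hlt]; auto.
      exfalso. destruct (valley V d I0 mid Im J ya) as (K & H1 & H2 & H3); auto; try lia.
      destruct (Hc' K H1) as [Hk _]. specialize (Hk H2). simpl in Hk. lia.
  - pose proof (crossing_up_walk V d ya yb Hd (mid ++ [Im]) I0) as H.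
    rewrite last_last in H. replace (Z.min ya (ye I0)) with ya in H by lia.
    apply H; auto.
    + apply (chain_up_ok V d I0 mid Im (col I0, ya)); auto.
    + constructor; [lia|]. apply Forall_app. split; [|constructor; auto; lia].
      apply Forall_forall. intros J HJ. destruct (Z.le_gt_cases (ys J) ya) as [|Hlt]; auto.
      exfalso. destruct (peak V d I0 mid Im J ya) as (K & H1 & H2 & H3); auto; try lia.
      destruct (Hc' K H1) as [_ Hk]. specialize (Hk H2). simpl in Hk. lia.
Qed.

(** * Non-key components and segments *)

Definition component_of (V : grid) (I : interval) : interval -> Prop :=
  clos_refl_trans interval (nonkey_neighbor V) I.

Lemma component_of_is V I : nonkey V I -> is_component V (component_of V I).
Proof. intros H. exists I. split; auto. intros; reflexivity. Qed.

Lemma connected_sym V I J : component_of V I J -> component_of V J I.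
Proof.
  induction 1 as [I J (H1 & H2 & H3) | I | I J K _ IH1 _ IH2].
  - apply rt_step. refine (conj H2 (conj H1 _)). now apply neighbor_sym.
  - apply rt_refl.
  - eapply rt_trans; eauto.
Qed.

Lemma component_connected V C I J : is_component V C -> C I -> (C J <-> component_of V I J).
Proof.
  intros (R & HR & HC) HI. apply HC in HI. rewrite HC. split; intros H.
  - eapply rt_trans; [apply connected_sym|]; eauto.
  - eapply rt_trans; eauto.
Qed.

Lemma connected_nonkey V I J : nonkey V I -> component_of V I J -> nonkey V J.
Proof. intros HI H. induction H as [I J (_ & H & _) | |]; auto. Qed.

Lemma component_nonkey V C I : is_component V C -> C I -> nonkey V I.
Proof. intros (R & HR & HC) HI. apply HC in HI. eapply connected_nonkey; eauto. Qed.

Definition joinable (V : grid) (C : interval -> Prop) (I J : interval) : Prop :=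
  I = J \/ exists d mid, (d = -1 \/ d = 1) /\
    Sorted (side_neighbor V d) (I :: mid ++ [J]) /\ Forall C mid.

Lemma joinable_sym V C I J : joinable V C I J -> joinable V C J I.
Proof.
  intros [->|(d & mid & Hd & HS & HF)]; [now left|]. right.
  exists (- d), (rev mid). split; [lia|]. split.
  - rewrite <- rev_ends. now apply (Sorted_side_rev V d).
  - apply Forall_rev, HF.
Qed.

(** A step in the direction of the chain prolongs it. A step back can only lead to the interval
    before [J], as [J] is non-key and has one neighbor on that side; the chain then gets shorter. *)
Lemma joinable_extend V C I J K : bounded V -> is_component V C -> C J ->
  joinable V C I J -> neighbor V J K -> joinable V C I K.
Proof.
  intros Hb HC HJ HIJ Hn. destruct (neighbor_side V J K Hn) as (e & He & HK).
  pose proof (component_nonkey V C J HC HJ) as Hnk.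
  destruct HIJ as [->|(d & mid & Hd & HS & HF)].
  - right. exists e, []. simpl. auto.
  - destruct (Z.eq_dec e d) as [->|Hne].
    + right. exists d, (mid ++ [J]). split; auto. split.
      * rewrite <- app_assoc. simpl. apply (Sorted_glue _ (I :: mid)). auto.
      * apply Forall_app; auto.
    + assert (E : e = - d) by lia.
      destruct (exists_last (l := I :: mid) ltac:(discriminate)) as (m' & P & Em).
      assert (HP : side_neighbor V e J P).
      { apply (side_neighbor_flip V d); auto.
        eapply (proj1 (Sorted_pairs _ _) HS m' P J []).
        change (I :: mid ++ [J]) with ((I :: mid) ++ [J]). rewrite Em. now rewrite <- app_assoc. }
      assert (K = P) by (eapply nonkey_side_unique; eauto). subst P.
      destruct m' as [|I' m']; injection Em as E1 E2; subst.
      * now left.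
      * right. exists d, m'. split; auto. split.
        -- change (I' :: (m' ++ [K]) ++ [J]) with ((I' :: m' ++ [K]) ++ [J]) in HS.
           replace ((I' :: m' ++ [K]) ++ [J]) with ((I' :: m') ++ K :: [J]) in HS
             by (simpl; now rewrite <- app_assoc).
           apply Sorted_glue in HS. apply HS.
        -- apply Forall_app in HF. apply HF.
Qed.

Lemma component_joinable V C I J : bounded V -> is_component V C -> C I -> C J -> joinable V C I J.
Proof.
  intros Hb HC HI HJ. apply (component_connected V C I J HC HI) in HJ.
  apply clos_rt_rtn1 in HJ. induction HJ as [|J K (_ & _ & Hn) HJ IH]; [now left|].
  apply (joinable_extend V C I J K); auto.
  apply (component_connected V C I J HC HI). now apply clos_rtn1_rt.
Qed.

(** A boundary interval is reached by one more extension from its neighbor in [C]; symmetry handles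
    the other end. *)
Lemma closure_joinable V C I J : bounded V -> is_component V C ->
  closure V C I -> closure V C J -> joinable V C I J.
Proof.
  intros Hb HC.
  assert (Hin : forall I J, C I -> closure V C J -> joinable V C I J).
  { clear I J. intros I J HI [HJ|[_ (J' & HJ' & Hn)]]; [now apply component_joinable|].
    apply (joinable_extend V C I J' J); auto. now apply component_joinable. }
  intros [HI|[_ (I' & HI' & Hn)]] HJ; [now apply Hin|].
  apply joinable_sym. apply (joinable_extend V C J I' I); auto. apply joinable_sym; auto.
Qed.

Lemma context_chain_exists V C I J : bounded V -> is_component V C ->
  closure V C I -> closure V C J -> I <> J -> exists G, context_chain V C I J G.
Proof.
  intros Hb HC HI HJ Hne.
  destruct (closure_joinable V C I J Hb HC HI HJ) as [|(d & mid & Hd & HS & HF)]; [easy|].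
  exists (I :: mid ++ [J]). repeat split; auto.
  - simpl. rewrite length_app. simpl. lia.
  - eauto.
  - eauto.
Qed.

(* A chain from the interval of the waypoint a to L along which no further
   waypoint is needed. *)
Definition tail_link (V : grid) (a : cell) (S : chain) (L : interval) : Prop :=
  is_interval V L /\ exists I, is_interval V I /\ in_interval a I /\
    ((S = [L] /\ I = L) \/
     exists d mid, (d = -1 \/ d = 1) /\ S = I :: mid ++ [L] /\
       Sorted (side_neighbor V d) S /\ Forall (clear V a) mid).

Definition good_link (V : grid) (S : chain) (a b : cell) : Prop :=
  exists L, tail_link V a S L /\ in_interval b L.

(* Positions in the route R are those recorded by [placed_waypoints]. *)
Definition link (V : grid) (R : chain) (p q : cell * nat) : Prop :=
  exists X S Y, R = X ++ S ++ Y /\ S <> [] /\ snd p = length X /\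
    snd q = (length X + length S - 1)%nat /\ good_link V S (fst p) (fst q).

Lemma context_chain_nonkey V C I J G : is_component V C -> context_chain V C I J G ->
  exists d mid, (d = -1 \/ d = 1) /\ G = I :: mid ++ [J] /\
    Sorted (side_neighbor V d) G /\ Forall C mid /\ Forall (nonkey V) mid.
Proof.
  intros HC (_ & _ & _ & (_ & d & Hd & HS) & mid & HG & HF).
  exists d, mid. repeat split; auto.
  eapply Forall_impl; [|exact HF]. intros K. now apply component_nonkey.
Qed.

(** A shared context rules out segments along the recorded chain. What remains runs inside one
    interval or through non-key intervals, which are clear. *)
Lemma segment_context_free_walk V a b seg : bounded V -> (exists C, share_context V C a b) ->
  forall rec, segment V rec a b seg -> walk V a b seg.
Proof.
  intros Hb [C0 HC0] rec [I HI Ha Hb' | Ia Ib C G HIa Ha HIb Hbb Hne (HC & _) HG | Ia Ib _ _ _ _ _ Hno].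
  - destruct a as [xa ya], b as [xb yb], Ha as [Ea Ha], Hb' as [Eb Hbb]; simpl in *; subst.
    now apply run_in_interval.
  - destruct (context_chain_nonkey V C Ia Ib G HC HG) as (d & mid & Hd & -> & HS & _ & HF).
    eapply crossing_path_walk; eauto.
    eapply Forall_impl; [|exact HF]. intros K. apply nonkey_clear.
  - now destruct (Hno C0).
Qed.

(** Without a shared context the recorded chain is used, and [good_link] says that it runs from the
    interval of [a] to that of [b] with clear interior. *)
Lemma segment_walk V S a b seg : bounded V -> good_link V S a b ->
  segment V S a b seg -> walk V a b seg.
Proof.
  intros Hb (L & (HL & I & HI & HaI & Hlink) & HbL) Hseg.
  destruct (classic (exists C, share_context V C a b)) as [HC|Hno].
  - eapply segment_context_free_walk; eauto.
  - destruct Hseg as [I' HI' Ha Hb' | Ia Ib C G HIa Ha HIb Hbb Hne HC HG | Ia Ib HIa Ha HIb Hbb Hne _].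
    + destruct a as [xa ya], b as [xb yb], Ha as [Ea Ha], Hb' as [Eb Hbb]; simpl in *; subst.
      now apply run_in_interval.
    + exfalso. eauto.
    + assert (Ia = I) by (eapply interval_unique; eauto).
      assert (Ib = L) by (eapply interval_unique; eauto). subst Ia Ib.
      destruct Hlink as [[_ E]|(d & mid & Hd & -> & HS & HF)]; [easy|].
      eapply crossing_path_walk; eauto.
Qed.

Lemma share_context_joins V C a b Ia Ib : bounded V -> share_context V C a b ->
  is_interval V Ia -> in_interval a Ia -> is_interval V Ib -> in_interval b Ib ->
  Ia <> Ib -> exists G, context_chain V C Ia Ib G.
Proof.
  intros Hb (HC & (Ia' & H1 & H2 & H3) & (Ib' & H4 & H5 & H6)) HIa Ha HIb Hbb Hne.
  assert (Ia' = Ia) by (eapply interval_unique; eauto).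
  assert (Ib' = Ib) by (eapply interval_unique; eauto). subst.
  now apply context_chain_exists.
Qed.

Lemma segment_exists V rec a b : bounded V -> V a = true -> V b = true ->
  exists seg, segment V rec a b seg.
Proof.
  intros Hb Ha Hbb.
  destruct (interval_exists V a Hb Ha) as (Ia & HIa & HaI).
  destruct (interval_exists V b Hb Hbb) as (Ib & HIb & HbI).
  destruct (interval_eq_dec Ia Ib) as [->|Hne]; [eexists; eapply segment_vertical; eauto|].
  destruct (classic (exists C, share_context V C a b)) as [[C HC]|Hno].
  - destruct (share_context_joins V C a b Ia Ib) as [G HG]; auto.
    eexists. apply (segment_context V rec a b Ia Ib C G); auto.
  - eexists. apply (segment_branch V rec a b Ia Ib); eauto.
Qed.

Lemma good_link_cells V S a b : good_link V S a b -> V a = true /\ V b = true.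
Proof.
  intros (L & (HL & I & HI & Ha & _) & Hb).
  split; [apply (in_interval_cell V I a) | apply (in_interval_cell V L b)]; auto.
Qed.

(** Both positions are inclusive: the [- 1] in [link] and the [+ 1] in [slice] cancel. *)
Lemma link_slice V R a i b j : link V R (a, i) (b, j) -> good_link V (slice i j R) a b.
Proof.
  intros (X & S & Y & -> & HS & E1 & E2 & H). simpl in *. subst.
  unfold slice. rewrite skipn_app, skipn_all, Nat.sub_diag. simpl.
  replace (length X + length S - 1 - length X + 1)%nat with (length S)
    by (destruct S; [easy|simpl; lia]).
  rewrite firstn_app, firstn_all, Nat.sub_diag, app_nil_r. exact H.
Qed.

Lemma link_extend V R Z0 p q : link V R p q -> link V (R ++ Z0) p q.
Proof.
  intros (X & S & Y & -> & H). exists X, S, (Y ++ Z0).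
  now rewrite <- !app_assoc.
Qed.

Lemma joined_exists V R P : bounded V -> forall p, V (fst p) = true ->
  Sorted (link V R) (p :: P) -> exists q, joined V R (p :: P) q.
Proof.
  intros Hb. induction P as [|[b j] P IH]; intros [a i] Ha HS.
  - eexists. constructor.
  - apply Sorted_inv in HS as [HS Hhd]. apply HdRel_inv, link_slice in Hhd.
    pose proof (good_link_cells _ _ _ _ Hhd) as [_ Hbb].
    destruct (segment_exists V (slice i j R) a b Hb Ha Hbb) as [seg Hseg].
    destruct (IH (b, j) Hbb HS) as [q Hq]. eexists. econstructor; eauto.
Qed.

Lemma joined_walk V R P q : bounded V -> joined V R P q -> forall p P', P = p :: P' ->
  V (fst p) = true -> Sorted (link V R) P -> walk V (fst p) (fst (last P' p)) q.
Proof.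
  intros Hb. induction 1 as [w i | a i b j W seg q Hseg Hq IH]; intros p P' E Hp HS;
    injection E as <- <-.
  - now constructor.
  - apply Sorted_inv in HS as [HS Hhd]. apply HdRel_inv, link_slice in Hhd.
    pose proof (good_link_cells _ _ _ _ Hhd) as [_ Hbb].
    rewrite last_cons. eapply walk_join; [eapply segment_walk; eauto|].
    apply (IH (b, j) W eq_refl Hbb HS).
Qed.

(** * Waypoints recorded on a search branch *)

Lemma chain_entry_app S G : (2 <= length G)%nat -> chain_entry (S ++ G) = chain_entry G.
Proof.
  intros H. unfold chain_entry. rewrite length_app, nth_error_app2 by lia. f_equal. lia.
Qed.

Definition path_inv (V : grid) (s : cell) (c : state) : Prop :=
  waypoints (node_of c) = map fst (placed_waypoints c) /\
  (exists i P, placed_waypoints c = (s, i) :: P) /\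
  Sorted (link V (route c)) (placed_waypoints c).

(** [S] is the part of the route after the last waypoint. Its last interval but one is the incoming
    interval, so the test for [K.T] compares the next exit with the direction of [S]. *)
Definition tail_inv (V : grid) (c : state) (K : interval) : Prop :=
  exists W a X S, placed_waypoints c = W ++ [(a, length X)] /\ route c = X ++ S /\
    tail_link V a S K /\
    ((N_in (node_of c) = None /\ S = [K]) \/
     ((2 <= length S)%nat /\ N_in (node_of c) = chain_entry S)).

Definition open_inv (V : grid) (s : cell) (c : state) (K : interval) : Prop :=
  key V K /\ path_inv V s c /\ tail_inv V c K.

Lemma reconstructs_exists V s c : bounded V -> V s = true -> path_inv V s c ->
  exists p, reconstructs V c p.
Proof.
  intros Hb Hs (_ & (i & P & E) & HS). unfold reconstructs. rewrite E in *.
  apply joined_exists; auto.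
Qed.

Lemma map_last {A B} (f : A -> B) l d : last (map f l) (f d) = f (last l d).
Proof.
  revert d. induction l as [|x l IH]; intros d; auto.
  change (map f (x :: l)) with (f x :: map f l). rewrite !last_cons. apply IH.
Qed.

Lemma reconstructs_walk V s c p : bounded V -> V s = true -> path_inv V s c ->
  reconstructs V c p -> walk V s (last_waypoint c) p.
Proof.
  intros Hb Hs (HW & (i & P & E) & HS) Hp. unfold reconstructs, last_waypoint in *.
  rewrite HW. rewrite E in *.
  change (map fst ((s, i) :: P)) with (s :: map fst P). rewrite last_cons.
  change s with (fst (s, i)) at 2. rewrite map_last.
  eapply (joined_walk V _ _ _ Hb Hp (s, i) P); auto.
Qed.

Lemma tail_link_last V a S K : tail_link V a S K -> exists S0, S = S0 ++ [K].
Proof.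
  intros (_ & I & _ & _ & [[-> _]|(d & mid & _ & -> & _)]).
  - now exists [].
  - now exists (I :: mid).
Qed.

Lemma tail_last_waypoint V s c W a i : path_inv V s c ->
  placed_waypoints c = W ++ [(a, i)] -> last_waypoint c = a.
Proof.
  intros (HW & _) E. unfold last_waypoint. rewrite HW, E, map_app. simpl. apply last_last.
Qed.

Lemma transition_exists V rep d K A B : bounded V ->
  side_neighbor V d K A -> side_neighbor V d K B -> A <> B ->
  exists v, transition V rep K (Some A) (Some B) v.
Proof.
  intros Hb HA HB Hne.
  destruct (Z.lt_trichotomy (ys A) (ys B)) as [H|[H|H]].
  - destruct (consecutive_exists V d K A B Hb HA HB H) as [J HJ].
    exists (rep K A J), d, A, B, A, J. repeat split; auto; try apply HA; try apply HB; try apply HJ.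
  - exfalso. apply Hne. eapply same_side_start; eauto.
  - destruct (consecutive_exists V d K B A Hb HB HA H) as [J HJ].
    exists (rep K B J), d, A, B, B, J. repeat split; auto; try apply HA; try apply HB; try apply HJ.
Qed.

(** Failure of the rules for [K.up] and [K.down] is exactly the property [clear]; any appended
    waypoint lies in [K]. *)
Lemma waypoint_rule_cases V rep K Nin Nout w ext : valid_gap_choice V rep -> key V K ->
  waypoint_rule V rep K Nin Nout w ext ->
  (exists v, ext = [v] /\ in_interval v K) \/
  (ext = [] /\ (forall v, ~ transition V rep K Nin Nout v) /\ clear V w K).
Proof.
  intros Hrep HK H. assert (Hse : ys K <= ye K) by apply HK.
  destruct H as [v (d & A & B & L & J & _ & _ & _ & _ & _ & _ & HC & ->) | _ _ | _ _ _ | H1 H2 H3].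
  - left. eexists. split; auto. apply (Hrep d K L J); auto.
  - left. eexists. split; auto. split; simpl; auto. lia.
  - left. eexists. split; auto. split; simpl; auto. lia.
  - right. split; auto. split; auto. split; intros HL.
    + destruct (Z.le_gt_cases (snd w) (ye K)); auto. exfalso. apply H2. split; auto. lia.
    + destruct (Z.le_gt_cases (ys K) (snd w)); auto. exfalso. apply H3. auto.
Qed.

(** Common form of an edge, of the chain from a key interval to that of [t], and of the trivial
    chain when [t] lies in [K]. *)
Definition leg (V : grid) (K L : interval) (Nout : option interval) (G : chain) : Prop :=
  (G = [K] /\ L = K /\ Nout = None) \/
  (exists d mid, (d = -1 \/ d = 1) /\ G = K :: mid ++ [L] /\
     Sorted (side_neighbor V d) G /\ Forall (nonkey V) mid /\ Nout = chain_exit G).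

Definition placed_at (R : chain) (ext : list cell) : list (cell * nat) :=
  map (fun w => (w, (length R - 1)%nat)) ext.

Lemma tail_link_leg V v K L Nout G : is_interval V K -> is_interval V L -> in_interval v K ->
  leg V K L Nout G -> tail_link V v G L.
Proof.
  intros HK HL Hv HG. split; auto. exists K. repeat (split; auto).
  destruct HG as [(-> & -> & _)|(d & mid & Hd & -> & HS & HF & _)]; [now left|].
  right. exists d, mid. repeat split; auto.
  eapply Forall_impl; [|exact HF]. intros I. apply nonkey_clear.
Qed.

(** With no waypoint appended, [K] is clear and becomes an interior interval of the tail. *)
Lemma tail_link_extend V rep a K L S Nin Nout G : bounded V -> is_interval V L ->
  tail_link V a S K -> leg V K L Nout G -> clear V a K ->
  (forall v, ~ transition V rep K Nin Nout v) -> ~ (Nin <> None /\ Nout = Nin) ->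
  ((Nin = None /\ S = [K]) \/ ((2 <= length S)%nat /\ Nin = chain_entry S)) ->
  tail_link V a (S ++ tl G) L.
Proof.
  intros Hb HL [HK (I & HI & HaI & HS)] HG Hclear Htr Hnd Hin.
  destruct HS as [[-> ->]|(d & mid & Hd & -> & HS & HF)].
  - replace ([K] ++ tl G) with G
      by (destruct HG as [(-> & _)|(d & mid & _ & -> & _)]; reflexivity).
    eapply tail_link_leg; eauto.
  - destruct HG as [(-> & -> & _)|(d2 & mid2 & Hd2 & -> & HS2 & HF2 & HNout)].
    + simpl. rewrite app_nil_r. split; auto. exists I. repeat (split; auto).
      right. exists d, mid. auto.
    + destruct (exists_last (l := I :: mid) ltac:(discriminate)) as (m & A & Em).
      change (I :: mid ++ [K]) with ((I :: mid) ++ [K]) in *.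
      assert (HA : side_neighbor V (- d) K A).
      { apply side_neighbor_sym. eapply (proj1 (Sorted_pairs _ _) HS m A K []).
        rewrite Em. now rewrite <- app_assoc. }
      assert (HNin : Nin = Some A).
      { destruct Hin as [[_ E]|[_ E]]; [destruct mid; discriminate|].
        rewrite E, Em, <- app_assoc. simpl. rewrite chain_entry_app by (simpl; lia). reflexivity. }
      assert (HB : exists B, Nout = Some B /\ side_neighbor V d2 K B).
      { subst Nout. apply Sorted_inv in HS2 as [_ HS2].
        destruct mid2; apply HdRel_inv in HS2; eexists; split; eauto; reflexivity. }
      destruct HB as (B & HB1 & HB2). subst Nin. rewrite HB1 in *.
      (* If the route turned at [K], exit and entry would lie on the same side: equal ones are
         discarded, distinct ones have a transition vertex. *)
      assert (d2 = d).
      { destruct (Z.eq_dec d2 d) as [|Hne]; auto. exfalso.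
        replace d2 with (- d) in HB2 by lia.
        destruct (transition_exists V rep (- d) K A B Hb HA HB2) as [v Hv].
        - intros ->. apply Hnd. split; congruence.
        - apply (Htr v Hv). }
      subst d2. split; auto. exists I. repeat (split; auto). right.
      assert (E : ((I :: mid) ++ [K]) ++ tl (K :: mid2 ++ [L]) = I :: (mid ++ K :: mid2) ++ [L])
        by (simpl; now rewrite <- !app_assoc).
      exists d, (mid ++ K :: mid2). rewrite E. repeat (split; auto).
      * rewrite <- app_assoc. apply (Sorted_glue _ (I :: mid)). split; auto.
      * apply Forall_app. split; auto. constructor; auto.
        eapply Forall_impl; [|exact HF2]. intros J. apply nonkey_clear.
Qed.

(** An appended waypoint closes the old tail [S] as a link and starts a new tail [G] at [K];
    otherwise the old tail grows by [G]. *)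
Lemma tail_extend V rep s c K L Nout G ext : bounded V -> valid_gap_choice V rep ->
  open_inv V s c K -> is_interval V L -> leg V K L Nout G ->
  ~ (N_in (node_of c) <> None /\ Nout = N_in (node_of c)) ->
  waypoint_rule V rep K (N_in (node_of c)) Nout (last_waypoint c) ext ->
  Sorted (link V (route c ++ tl G)) (placed_waypoints c ++ placed_at (route c) ext) /\
  exists W a X S,
    placed_waypoints c ++ placed_at (route c) ext = W ++ [(a, length X)] /\
    route c ++ tl G = X ++ S /\ tail_link V a S L /\
    ((2 <= length G)%nat -> (2 <= length S)%nat /\ chain_entry S = chain_entry G).
Proof.
  intros Hb Hrep (HK & Hpath & W & a & X & S & HP & HR & Htail & Hin) HL HG Hnd Hrule.
  pose proof (tail_last_waypoint V s c _ _ _ Hpath HP) as Ew. rewrite Ew in Hrule.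
  assert (HS : Sorted (link V (route c ++ tl G)) (W ++ [(a, length X)])).
  { rewrite <- HP. destruct Hpath as (_ & _ & HS). revert HS. rewrite !Sorted_pairs.
    intros HS l1 x y l2 E. apply link_extend. eauto. }
  destruct (tail_link_last _ _ _ _ Htail) as [S0 ES].
  assert (EG : G = K :: tl G) by (destruct HG as [(-> & _)|(d & mid & _ & -> & _)]; reflexivity).
  destruct (waypoint_rule_cases V rep K _ _ _ _ Hrep HK Hrule)
    as [(v & -> & Hv)|(-> & Htr & Hclear)].
  - split.
    + rewrite HP, <- app_assoc. apply (Sorted_glue _ W). split; auto.
      repeat constructor. exists X, S, (tl G). rewrite HR, <- app_assoc. split; auto.
      split; [subst S; now destruct S0|]. split; auto. split; [simpl; now rewrite length_app|].
      exists K. auto.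
    (* [K] ends the old tail and begins [G], so the new tail starts at the last position of the
       route of [c]. *)
    + exists (W ++ [(a, length X)]), v, (X ++ S0), G. split; [|split; [|split]].
      * rewrite HP. f_equal. unfold placed_at. simpl. rewrite HR, ES, !length_app. simpl.
        now replace (length X + (length S0 + 1) - 1)%nat with (length X + length S0)%nat by lia.
      * rewrite HR, ES, <- !app_assoc. simpl. now rewrite <- EG.
      * apply (tail_link_leg V v K L Nout G); auto. apply HK.
      * auto.
  - simpl. rewrite app_nil_r. split; [now rewrite HP|].
    exists W, a, X, (S ++ tl G). split; [auto|]. split; [now rewrite HR, <- app_assoc|].
    split.
    + eapply tail_link_extend; eauto.
    + intros H2. rewrite ES, <- app_assoc. simpl. rewrite <- EG, chain_entry_app by auto.
      rewrite length_app. split; auto. lia.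
Qed.

Lemma skipn_length_app {A} (l l' : list A) : skipn (length l) (l ++ l') = l'.
Proof. rewrite skipn_app, skipn_all, Nat.sub_diag. reflexivity. Qed.

Lemma map_fst_placed_at R ext : map fst (placed_at R ext) = ext.
Proof. unfold placed_at. rewrite map_map. simpl. apply map_id. Qed.

Lemma successor_open_inv V rep s c K K' G ext : bounded V -> valid_gap_choice V rep ->
  open_inv V s c K -> key_edge V K K' G ->
  ~ (N_in (node_of c) <> None /\ chain_exit G = N_in (node_of c)) ->
  waypoint_rule V rep K (N_in (node_of c)) (chain_exit G) (last_waypoint c) ext ->
  open_inv V s (Successor c (Node (Some K') (chain_entry G)
    (waypoints (node_of c) ++ ext ++ []) G)) K'.
Proof.
  intros Hb Hrep Hinv (HK & HK' & (Hlen & d & Hd & HS) & mid & HG & HF) Hnd Hrule.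
  destruct (tail_extend V rep s c K K' (chain_exit G) G ext) as (H1 & W & a & X & S & H2 & H3 & H4 & H5);
    auto; [apply HK' | right; exists d, mid; auto|].
  destruct Hinv as (_ & (HW & (i & P & HP) & _) & _).
  assert (E : placed_waypoints (Successor c (Node (Some K') (chain_entry G)
    (waypoints (node_of c) ++ ext ++ []) G)) = placed_waypoints c ++ placed_at (route c) ext).
  { simpl. now rewrite app_nil_r, skipn_length_app. }
  split; auto. split.
  - split; [|split].
    + rewrite E, map_app, map_fst_placed_at, <- HW. simpl. now rewrite app_nil_r.
    + rewrite E, HP. simpl. eauto.
    + rewrite E. exact H1.
  - exists W, a, X, S. rewrite E. split; auto. split; auto. split; auto.
    right. destruct (H5 Hlen). simpl. auto.
Qed.

Lemma successor_terminal_inv V rep s t c K L Nout G ext : bounded V -> valid_gap_choice V rep ->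
  open_inv V s c K -> is_interval V L -> in_interval t L -> leg V K L Nout G ->
  ~ (N_in (node_of c) <> None /\ Nout = N_in (node_of c)) ->
  waypoint_rule V rep K (N_in (node_of c)) Nout (last_waypoint c) ext ->
  let c' := Successor c (Node None None (waypoints (node_of c) ++ ext ++ [t]) G) in
  path_inv V s c' /\ last_waypoint c' = t.
Proof.
  intros Hb Hrep Hinv HL Ht HG Hnd Hrule c'.
  destruct (tail_extend V rep s c K L Nout G ext) as (H1 & W & a & X & S & H2 & H3 & H4 & _); auto.
  destruct Hinv as (_ & (HW & (i & P & HP) & _) & _).
  assert (E : placed_waypoints c' = (placed_waypoints c ++ placed_at (route c) ext) ++
    [(t, (length (route c') - 1)%nat)]).
  { unfold c'. cbn [placed_waypoints waypoints node_of key_of].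
    rewrite skipn_length_app, removelast_last, last_last, app_assoc. reflexivity. }
  split; [split; [|split]|].
  - rewrite E, !map_app, map_fst_placed_at, <- HW. simpl. now rewrite <- app_assoc.
  - rewrite E, HP. simpl. eauto.
  - rewrite E. change (route c') with (route c ++ tl G). rewrite H2, <- app_assoc in *.
    apply (Sorted_glue _ W). split; auto. repeat constructor.
    exists X, S, []. rewrite app_nil_r. split; auto.
    split; [destruct (tail_link_last _ _ _ _ H4) as [S0 ->]; now destruct S0|].
    split; auto. split; [simpl; now rewrite H3, length_app|]. exists L. auto.
  - unfold last_waypoint, c'. simpl. rewrite app_assoc. apply last_last.
Qed.

Lemma initial_key_inv V s I : key V I -> in_interval s I ->
  open_inv V s (Initial (Node (Some I) None [s] [I])) I.
Proof.
  intros HK Hs. split; auto. split; [split; [|split]|]; simpl; eauto.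
  exists [], s, [], [I]. repeat (split; auto); try apply HK.
  exists I. repeat (split; auto); try apply HK.
Qed.

Lemma initial_nonkey_inv V C s I K G : is_component V C -> is_interval V I -> in_interval s I ->
  key V K -> context_chain V C I K G ->
  open_inv V s (Initial (Node (Some K) (chain_entry G) [s] G)) K.
Proof.
  intros HC HI Hs HK HG. pose proof HG as (_ & _ & _ & (Hlen & _) & _).
  destruct (context_chain_nonkey V C I K G HC HG) as (d & mid & Hd & E & HS & _ & HF).
  split; auto. split; [split; [|split]|]; simpl; eauto.
  exists [], s, [], G. split; auto. split; auto. split; [|auto].
  split; [apply HK|]. exists I. repeat (split; auto). right. exists d, mid.
  repeat (split; auto). eapply Forall_impl; [|exact HF]. intros J. apply nonkey_clear.
Qed.

(** * Progress of the search *)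

Lemma Forall2_exists {A B} (R : A -> B -> Prop) l :
  (forall x, In x l -> exists y, R x y) -> exists l', Forall2 R l l'.
Proof.
  induction l as [|x l IH]; intros H; [exists []; constructor|].
  destruct (H x (or_introl eq_refl)) as [y Hy].
  destruct IH as [l' Hl']; [intros; apply H; now right|].
  exists (y :: l'). now constructor.
Qed.

Fixpoint lists_upto {A} (l : list A) (n : nat) : list (list A) :=
  match n with
  | O => [[]]
  | S n => [] :: flat_map (fun x => map (cons x) (lists_upto l n)) l
  end.

Lemma in_lists_upto {A} (l : list A) n L :
  (forall x, In x L -> In x l) -> (length L <= n)%nat -> In L (lists_upto l n).
Proof.
  revert L. induction n as [|n IH]; intros [|x L] Hin Hlen; simpl in *; try lia; auto.
  right. apply in_flat_map. exists x. split; auto. apply in_map, IH; auto. lia.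
Qed.

Lemma chain_last_col V d G : forall I, Sorted (side_neighbor V d) (I :: G) ->
  col (last G I) = col I + d * Z.of_nat (length G).
Proof.
  induction G as [|J G IH]; intros I HS; [simpl; lia|].
  apply Sorted_inv in HS as [HS Hhd]. apply HdRel_inv in Hhd as [_ E].
  rewrite last_cons, IH by auto. simpl length. lia.
Qed.

(** A monotone chain meets each column at most once, so its length is bounded by the width of the
    grid and it occurs in a finite enumeration. *)
Lemma key_edges_finite V K : bounded V ->
  exists Gs, NoDup Gs /\ forall G, In G Gs <-> exists K', key_edge V K K' G.
Proof.
  intros Hb. destruct (intervals_finite V Hb) as (l & _ & Hl). destruct Hb as (M & N & Hg).
  destruct (filter_Prop (fun G => exists K', key_edge V K K' G)
    (nodup (list_eq_dec interval_eq_dec) (lists_upto l (S M)))) as (Gs & H1 & H2);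
    [apply NoDup_nodup|].
  exists Gs. split; auto. intros G. rewrite H2, nodup_In. split; [tauto|].
  intros H. split; auto. destruct H as (K' & HK & HK' & (_ & d & Hd & HS) & mid & -> & HF).
  apply in_lists_upto.
  - intros I HI. apply Hl. destruct HI as [<-|HI]; [apply HK|].
    apply in_app_iff in HI as [HI|[<-|[]]]; [|apply HK'].
    rewrite Forall_forall in HF. now apply HF.
  - apply chain_last_col in HS. rewrite last_last in HS. simpl length.
    destruct HK as [HK _], HK' as [HK' _].
    apply (interval_bounds _ _ _ _ Hg) in HK, HK'. destruct Hd; subst d; lia.
Qed.

Lemma waypoint_rule_exists V rep K Nin Nout w : exists ext, waypoint_rule V rep K Nin Nout w ext.
Proof.
  destruct (classic (exists v, transition V rep K Nin Nout v)) as [[v Hv]|Hno].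
  { eexists. eapply rule_transition; eauto. }
  assert (Hno' : forall v, ~ transition V rep K Nin Nout v) by eauto.
  destruct (classic (end_labeled V K /\ snd w > ye K)); [eexists; apply rule_up; auto|].
  destruct (classic (start_labeled V K /\ snd w < ys K));
    eexists; [apply rule_down; auto | apply rule_none; auto].
Qed.

Lemma candidate_exists V rep c K Nout K' Nin' G final :
  exists l, candidate V rep c K Nout K' Nin' G final l.
Proof.
  destruct (classic (N_in (node_of c) <> None /\ Nout = N_in (node_of c))) as [[H1 H2]|H].
  - exists []. now constructor.
  - destruct (waypoint_rule_exists V rep K (N_in (node_of c)) Nout (last_waypoint c)) as [ext He].
    eexists. eapply candidate_kept; eauto.
Qed.

Lemma nonkey_not_key V I : nonkey V I -> key V I -> False.
Proof. intros [_ H] H'. auto. Qed.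

Lemma expands_exists V rep t c K : bounded V -> key_of (node_of c) = Some K ->
  exists succs, expands V rep t c succs.
Proof.
  intros Hb HK. destruct (classic (query_keys V t K)) as [HQ|HQ].
  - pose proof HQ as (I & HI & Ht & [[HkI ->]|(Hn & C & HC & HCI & HB)]).
    + destruct (candidate_exists V rep c I None None None [I] [t]) as [l Hl].
      exists l. eapply expands_at_target; eauto.
    + assert (Hne : I <> K) by (intros ->; eapply nonkey_not_key; eauto; apply HB).
      destruct (context_chain_exists V C K I Hb HC) as [G HG]; auto; [now right | now left|].
      destruct (candidate_exists V rep c K (chain_exit G) None None G [t]) as [l Hl].
      exists l. eapply expands_to_target; eauto.
  - destruct (key_edges_finite V K Hb) as (Gs & HGs & HG).
    destruct (Forall2_exists (fun G l => exists K', key_edge V K K' G /\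
      candidate V rep c K (chain_exit G) (Some K') (chain_entry G) G [] l) Gs) as [ls Hls].
    + intros G Hin. apply HG in Hin as [K' HK'].
      destruct (candidate_exists V rep c K (chain_exit G) (Some K') (chain_entry G) G []) as [l Hl].
      eauto.
    + exists (concat ls). eapply expands_edges; eauto.
Qed.

Lemma initial_states_exists V s : bounded V -> V s = true -> exists l, initial_states V s l.
Proof.
  intros Hb Hs. destruct (interval_exists V s Hb Hs) as (I & HI & HsI).
  destruct (classic (key V I)) as [Hk|Hn].
  - eexists. exists I. eauto.
  - assert (HnI : nonkey V I) by (split; auto).
    pose proof (component_of_is V I HnI) as HC.
    destruct (intervals_finite V Hb) as (l & Hl1 & Hl2).
    destruct (filter_Prop (boundary V (component_of V I)) l Hl1) as (Ks & HKs1 & HKs2).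
    destruct (Forall2_exists (fun K c => exists G, context_chain V (component_of V I) I K G /\
      c = Initial (Node (Some K) (chain_entry G) [s] G)) Ks) as [ls Hls].
    + intros K HK. apply HKs2 in HK as [_ HK].
      destruct (context_chain_exists V (component_of V I) I K Hb HC) as [G HG].
      * left. apply rt_refl.
      * now right.
      * intros ->. eapply nonkey_not_key; eauto; apply HK.
      * eauto.
    + exists ls, I. split; auto. split; auto. right. split; auto.
      exists (component_of V I), Ks. split; auto. split; [apply rt_refl|]. split; auto.
      split; auto. intros K. rewrite HKs2. split; [tauto|].
      intros HK. split; auto. apply Hl2. apply HK.
Qed.

(** * Termination *)

Lemma waypoint_cost_nonneg W : 0 <= waypoint_cost W.
Proof.
  induction W as [|a [|b W] IH]; [reflexivity | reflexivity |].
  assert (0 <= manhattan a b) by (unfold manhattan; lia).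
  change (0 <= manhattan a b + waypoint_cost (b :: W)). lia.
Qed.

Lemma g_value_nonneg c : 0 <= g_value c.
Proof.
  unfold g_value. pose proof (waypoint_cost_nonneg (waypoints (node_of c))).
  destruct (key_of (node_of c)); unfold manhattan; lia.
Qed.

Definition row (K : interval) (c : state) : Z := snd (projection K (last_waypoint c)).

Lemma dominates_spec c1 c2 : dominates c1 c2 = true <->
  exists K, key_of (node_of c1) = Some K /\ key_of (node_of c2) = Some K /\
    g_value c1 + Z.abs (row K c1 - row K c2) <= g_value c2.
Proof.
  unfold dominates. split.
  - destruct (key_of (node_of c1)) as [K1|]; [|discriminate].
    destruct (key_of (node_of c2)) as [K2|]; [|discriminate].
    destruct (interval_eq_dec K1 K2) as [->|]; [|discriminate].
    intros H. exists K2. repeat split; auto. now apply Z.leb_le.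
  - intros (K & -> & -> & H). destruct (interval_eq_dec K K); [|easy]. now apply Z.leb_le.
Qed.

(** A slot [q] is a row of a key interval; the value is the cost of entering at the projected row
    and moving to that row. [None] means that the state belongs to another interval or is
    terminal. *)
Definition state_cost (q : interval * Z) (c : state) : option nat :=
  match key_of (node_of c) with
  | Some K => if interval_eq_dec K (fst q)
              then Some (Z.to_nat (g_value c + Z.abs (snd q - row K c))) else None
  | None => None
  end.

Fixpoint best_cost (ret : list state) (q : interval * Z) : option nat :=
  match ret with
  | [] => None
  | c :: ret => match state_cost q c, best_cost ret q with
                | Some m, Some n => Some (Nat.min m n)
                | Some m, None => Some m
                | None, o => o
                end
  end.

(** In both comparisons [None] counts as infinity. *)
Definition opt_le (o' o : option nat) : Prop :=
  forall m, o = Some m -> exists m', o' = Some m' /\ (m' <= m)%nat.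

Definition opt_lt (o' o : option nat) : Prop :=
  exists m', o' = Some m' /\ forall m, o = Some m -> (m' < m)%nat.

Lemma best_cost_attained ret q m : best_cost ret q = Some m ->
  exists c, In c ret /\ state_cost q c = Some m.
Proof.
  revert m. induction ret as [|c ret IH]; intros m; simpl; [discriminate|].
  destruct (state_cost q c) as [a|] eqn:Ea; destruct (best_cost ret q) as [b|] eqn:Eb;
    intros E; try discriminate; injection E as <-.
  - destruct (Nat.min_spec a b) as [[_ ->]|[_ ->]]; [eauto|].
    destruct (IH b eq_refl) as (c' & ? & ?). eauto.
  - eauto.
  - destruct (IH b eq_refl) as (c' & ? & ?). eauto.
Qed.

Lemma best_cost_lower ret q c : In c ret -> opt_le (best_cost ret q) (state_cost q c).
Proof.
  induction ret as [|c' ret IH]; [easy|]; intros Hin m Hm; destruct Hin as [->|Hin]; simpl.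
  - rewrite Hm. destruct (best_cost ret q) as [b|]; eexists; split; eauto; lia.
  - destruct (IH Hin m Hm) as (m' & -> & Hle).
    destruct (state_cost q c') as [a|]; eexists; split; eauto; lia.
Qed.

Fixpoint unseen (Q : list (interval * Z)) (f : interval * Z -> option nat) : nat :=
  match Q with
  | [] => 0
  | q :: Q => (match f q with None => 1 | Some _ => 0 end + unseen Q f)%nat
  end.

Fixpoint total (Q : list (interval * Z)) (f : interval * Z -> option nat) : nat :=
  match Q with
  | [] => 0
  | q :: Q => (match f q with None => 0 | Some m => m end + total Q f)%nat
  end.

(** [total] may grow when a slot becomes finite, but then [unseen] drops, so the pair is compared
    lexicographically. *)
Lemma potential_le Q f f' : (forall q, opt_le (f' q) (f q)) ->
  (unseen Q f' < unseen Q f)%nat \/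
  ((unseen Q f' = unseen Q f)%nat /\ (total Q f' <= total Q f)%nat).
Proof.
  intros H. induction Q as [|q Q IH]; simpl; [lia|]. specialize (H q).
  destruct (f q) as [m|].
  - destruct (H m eq_refl) as (m' & -> & Hm). lia.
  - destruct (f' q); lia.
Qed.

Lemma potential_lt Q f f' q : (forall q, opt_le (f' q) (f q)) -> In q Q -> opt_lt (f' q) (f q) ->
  (unseen Q f' < unseen Q f)%nat \/
  ((unseen Q f' = unseen Q f)%nat /\ (total Q f' < total Q f)%nat).
Proof.
  intros H Hin (m' & Em' & Hm'). induction Q as [|q' Q IH]; [easy|]. simpl.
  destruct Hin as [->|Hin].
  - pose proof (potential_le Q f f' H). rewrite Em'. destruct (f q) as [m|]; [|lia].
    specialize (Hm' m eq_refl). lia.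
  - specialize (IH Hin). specialize (H q'). destruct (f q') as [m|].
    + destruct (H m eq_refl) as (m1 & -> & Hm). lia.
    + destruct (f' q'); lia.
Qed.

Definition potential_lt_ret (Q : list (interval * Z)) (ret' ret : list state) : Prop :=
  (unseen Q (best_cost ret') < unseen Q (best_cost ret))%nat \/
  ((unseen Q (best_cost ret') = unseen Q (best_cost ret))%nat /\
   (total Q (best_cost ret') < total Q (best_cost ret))%nat).

Lemma insert_potential Q op ret op' ret' c K : key_of (node_of c) = Some K ->
  In (K, row K c) Q -> insert_state (op, ret) c = (op', ret') ->
  (op' = op /\ ret' = ret) \/ potential_lt_ret Q ret' ret.
Proof.
  intros HK HQ. unfold insert_state. rewrite HK.
  destruct (existsb (fun c' => dominates c' c) ret) eqn:Ed; intros E; injection E as <- <-; auto.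
  right. set (keep := filter (fun c' => negb (dominates c c')) ret).
  assert (Hc : forall q, opt_le (best_cost (keep ++ [c]) q) (state_cost q c)).
  { intros q. apply best_cost_lower. apply in_app_iff. right. now left. }
  apply potential_lt with (q := (K, row K c)); auto.
  - intros q m Hm. apply best_cost_attained in Hm as (c0 & Hc0 & Hm).
    destruct (dominates c c0) eqn:Edom.
    (* The triangle inequality makes [c] at least as good as the dominated [c0] at every row of the
       interval. *)
    + apply dominates_spec in Edom as (K0 & H1 & H2 & H3).
      unfold state_cost in Hm. rewrite H2 in Hm.
      destruct (interval_eq_dec K0 (fst q)) as [Eq|]; [|discriminate]. injection Hm as <-.
      destruct (Hc q (Z.to_nat (g_value c + Z.abs (snd q - row K0 c)))) as (m' & Hm' & Hle).
      { unfold state_cost. rewrite H1. destruct (interval_eq_dec K0 (fst q)); easy. }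
      exists m'. split; auto. lia.
    + apply (best_cost_lower (keep ++ [c]) q c0); auto. apply in_app_iff. left.
      apply filter_In. split; auto. now rewrite Edom.
  - destruct (Hc (K, row K c) (Z.to_nat (g_value c))) as (m' & Hm' & Hle).
    { unfold state_cost. rewrite HK. simpl. destruct (interval_eq_dec K K); [|easy].
      do 2 f_equal. lia. }
    exists m'. split; auto. intros m Hm. apply best_cost_attained in Hm as (c0 & Hc0 & Hm).
    unfold state_cost in Hm. destruct (key_of (node_of c0)) as [K0|] eqn:EK0; [|discriminate].
    simpl in Hm. destruct (interval_eq_dec K0 K) as [->|]; [|discriminate]. injection Hm as <-.
    assert (Hnd : dominates c0 c = false).
    { destruct (dominates c0 c) eqn:E0; auto.
      enough (existsb (fun c' => dominates c' c) ret = true) by congruence.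
      apply existsb_exists. eauto. }
    (* A retained state reaching the row of [c] at cost at most [g_value c] would dominate [c]. *)
    assert (g_value c < g_value c0 + Z.abs (row K c0 - row K c)).
    { apply Z.nle_gt. intros Hle'. enough (dominates c0 c = true) by congruence.
      apply dominates_spec. eauto. }
    pose proof (g_value_nonneg c). lia.
Qed.

Lemma fold_potential Q cs :
  (forall c, In c cs -> exists K, key_of (node_of c) = Some K /\ In (K, row K c) Q) ->
  forall op ret op' ret', fold_left insert_state cs (op, ret) = (op', ret') ->
  (op' = op /\ ret' = ret) \/ potential_lt_ret Q ret' ret.
Proof.
  induction cs as [|c cs IH]; intros Hcs op ret op' ret' E; cbn [fold_left] in E.
  - injection E as <- <-. auto.
  - destruct (insert_state (op, ret) c) as [op1 ret1] eqn:E1 in E.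
    destruct (Hcs c (or_introl eq_refl)) as (K & HK & HQ).
    destruct (insert_potential Q op ret op1 ret1 c K HK HQ E1) as [[-> ->]|H1];
    destruct (IH (fun c H => Hcs c (or_intror H)) _ _ _ _ E) as [[-> ->]|H2]; auto.
    right. unfold potential_lt_ret in *. lia.
Qed.

(** Expansion at a key interval of [t] replaces a nonterminal state by a terminal one; the weights 2
    and 1 make this a decrease. *)
Definition weight (op : list state) : nat :=
  list_sum (map (fun c => match key_of (node_of c) with Some _ => 2 | None => 1 end) op)%nat.

Lemma weight_app l1 l2 : weight (l1 ++ l2) = (weight l1 + weight l2)%nat.
Proof. unfold weight. now rewrite map_app, list_sum_app. Qed.

Definition row_slots (l : list interval) : list (interval * Z) :=
  flat_map (fun I => map (fun k => (I, ys I + Z.of_nat k))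
    (seq 0 (Z.to_nat (ye I - ys I + 1)))) l.

Lemma in_row_slots V l K c : In K l -> is_interval V K -> In (K, row K c) (row_slots l).
Proof.
  intros HK (Hle & _). apply in_flat_map. exists K. split; auto. apply in_map_iff.
  exists (Z.to_nat (row K c - ys K)). unfold row, projection. simpl. split.
  - f_equal. lia.
  - apply in_seq. lia.
Qed.

Lemma lex_induction (P : nat -> nat -> nat -> Prop) :
  (forall a b c, (forall a' b' c', (a' < a \/ (a' = a /\ (b' < b \/ (b' = b /\ c' < c))))%nat ->
    P a' b' c') -> P a b c) -> forall a b c, P a b c.
Proof.
  intros H. induction a as [a IHa] using lt_wf_ind.
  induction b as [b IHb] using lt_wf_ind. induction c as [c IHc] using lt_wf_ind.
  apply H. intros a' b' c' [Ha|[-> [Hb|[-> Hc]]]]; auto.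
Qed.

(** * Completeness *)

Definition visited (ret : list state) (K : interval) : Prop :=
  exists c, In c ret /\ key_of (node_of c) = Some K.

Definition terminal_in (op : list state) : Prop :=
  exists c, In c op /\ key_of (node_of c) = None.

Definition open_retained (op ret : list state) : Prop :=
  forall c, In c op -> key_of (node_of c) <> None -> In c ret.

(** [ins_mono] holds because a removed state leaves behind a dominating one of the same key
    interval. [ins_ret] holds because domination deletes from both lists, so a retained state
    outside the open list was outside it before. *)
Record insertion (op ret op' ret' news : list state) : Prop := Insertion {
  ins_open : forall c, In c op' -> In c op \/ In c news;
  ins_mono : forall K, visited ret K -> visited ret' K;
  ins_visited : forall c K, In c news -> key_of (node_of c) = Some K -> visited ret' K;
  ins_ret : forall c, In c ret' -> In c op' \/ (In c ret /\ ~ In c op);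
  ins_retained : open_retained op ret -> open_retained op' ret';
  ins_terminal : forall c, In c op \/ In c news -> key_of (node_of c) = None -> In c op' }.

Lemma insert_insertion op ret op' ret' c :
  insert_state (op, ret) c = (op', ret') -> insertion op ret op' ret' [c].
Proof.
  unfold insert_state. destruct (key_of (node_of c)) as [K|] eqn:HK.
  - destruct (existsb (fun c' => dominates c' c) ret) eqn:Ed; intros E; injection E as <- <-.
    + apply existsb_exists in Ed as (c0 & Hc0 & Hd).
      apply dominates_spec in Hd as (K0 & H1 & H2 & _).
      split; auto.
      * intros c1 K1 [<-|[]] HK1. exists c0. split; auto. congruence.
      * intros c1 Hc1. destruct (classic (In c1 op)); auto.
      * intros c1 [H|[<-|[]]] E; auto. congruence.
    + split.
      * intros x Hx. apply in_app_iff in Hx as [Hx|Hx]; auto. apply filter_In in Hx. tauto.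
      * intros K1 (c1 & Hc1 & E1). destruct (dominates c c1) eqn:Ed1.
        -- apply dominates_spec in Ed1 as (K0 & H1 & H2 & _).
           exists c. split; [apply in_app_iff; right; now left | congruence].
        -- exists c1. split; auto. apply in_app_iff. left. apply filter_In. now rewrite Ed1.
      * intros c1 K1 [<-|[]] HK1. exists c. split; auto. apply in_app_iff. right. now left.
      * intros x Hx. apply in_app_iff in Hx as [Hx|Hx]; [|left; apply in_app_iff; auto].
        apply filter_In in Hx as [Hx1 Hx2]. destruct (classic (In x op)) as [Ho|Ho]; auto.
        left. apply in_app_iff. left. now apply filter_In.
      * intros Hr x Hx Hn. apply in_app_iff in Hx as [Hx|Hx]; apply in_app_iff; auto.
        left. apply filter_In in Hx as [Hx1 Hx2]. apply filter_In. auto.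
      * intros x [Hx|[<-|[]]] Hn; [|congruence]. apply in_app_iff. left.
        apply filter_In. split; auto. destruct (dominates c x) eqn:Ed1; auto.
        apply dominates_spec in Ed1 as (K0 & H1 & H2 & _). congruence.
  - intros E; injection E as <- <-. split.
    + intros x Hx. apply in_app_iff in Hx. auto.
    + auto.
    + intros c1 K1 [<-|[]] E. congruence.
    + intros x Hx. destruct (classic (In x op)); auto. left. apply in_app_iff. auto.
    + intros Hr x Hx Hn. apply in_app_iff in Hx as [Hx|[<-|[]]]; auto. congruence.
    + intros x Hx _. apply in_app_iff. auto.
Qed.

Lemma fold_insertion cs : forall op ret op' ret',
  fold_left insert_state cs (op, ret) = (op', ret') -> insertion op ret op' ret' cs.
Proof.
  induction cs as [|c cs IH]; intros op ret op' ret' E; cbn [fold_left] in E.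
  - injection E as <- <-. split; auto; try (intros; simpl in *; tauto).
  - destruct (insert_state (op, ret) c) as [op1 ret1] eqn:E1 in E.
    apply insert_insertion in E1. apply IH in E.
    destruct E1 as [A1 A2 A3 A4 A5 A6], E as [B1 B2 B3 B4 B5 B6]. split; auto.
    + intros x Hx. destruct (B1 x Hx) as [H|H]; [|simpl; auto].
      destruct (A1 x H) as [|[->|[]]]; simpl; auto.
    + intros x K [<-|Hx] HK; eauto. apply B2. eapply A3; eauto. now left.
    + intros x Hx. destruct (B4 x Hx) as [H|[H1 H2]]; auto.
      destruct (A4 x H1) as [|]; [easy | auto].
    + intros x [Hx|[<-|Hx]] HK; [| |]; apply B6; auto; left; apply A6; auto.
      right. now left.
Qed.

Definition settled (V : grid) (t : cell) (ret : list state) (K : interval) : Prop :=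
  ~ query_keys V t K /\ forall K' G, key_edge V K K' G -> visited ret K'.

(* An exit that the search refuses to take leads to a key interval already visited. *)
Definition entry_visited (V : grid) (ret : list state) (c : state) (K : interval) : Prop :=
  forall K' G, key_edge V K K' G -> chain_exit G = N_in (node_of c) -> visited ret K'.

(** Guards the terminal candidate against being discarded, since its exit lies in the component of
    [t] whenever [t] lies outside [K]. *)
Definition entry_free (V : grid) (t : cell) (c : state) : Prop :=
  forall A I, N_in (node_of c) = Some A -> nonkey V A -> is_interval V I ->
    in_interval t I -> ~ component_of V A I.

Definition state_inv (V : grid) (s t : cell) (c : state) : Prop :=
  match key_of (node_of c) with
  | Some K => open_inv V s c K /\ entry_free V t c
  | None => path_inv V s c /\ last_waypoint c = t
  end.

(** In [inv_complete] the first case persists, as dominance never removes a terminal state and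
    extracting one ends the search. In the second case an empty open list leaves only settled key
    intervals. *)
Record search_inv (V : grid) (s t : cell) (op ret : list state) : Prop := SearchInv {
  inv_state : forall c, In c op -> state_inv V s t c;
  inv_retained : open_retained op ret;
  inv_entry : forall c K, In c op -> key_of (node_of c) = Some K -> entry_visited V ret c K;
  inv_complete : terminal_in op \/
    ((forall c K, In c ret -> key_of (node_of c) = Some K -> In c op \/ settled V t ret K) /\
     (forall K, query_keys V s K -> visited ret K)) }.

(** * Edges of the key-interval graph and the components they traverse *)

Lemma chain_connected V d G : Forall (nonkey V) G -> Sorted (side_neighbor V d) G ->
  forall I J, In I G -> In J G -> component_of V I J.
Proof.
  intros HF HS.
  assert (Hhd : forall I G J, Forall (nonkey V) (I :: G) ->
    Sorted (side_neighbor V d) (I :: G) -> In J (I :: G) -> component_of V I J).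
  { clear. intros I G. revert I. induction G as [|I' G IH]; intros I J HF HS HJ.
    - destruct HJ as [<-|[]]. apply rt_refl.
    - destruct HJ as [<-|HJ]; [apply rt_refl|].
      inversion HF as [|? ? H1 H2]; subst. inversion H2; subst.
      apply Sorted_inv in HS as [HS Hs]. apply HdRel_inv in Hs as [Hs _].
      eapply rt_trans; [apply rt_step | apply (IH I' J); eauto].
      exact (conj H1 (conj H3 Hs)). }
  intros I J HI HJ. destruct G as [|R G]; [easy|].
  apply rt_trans with (y := R); [apply connected_sym|]; eapply Hhd; eauto.
Qed.

Lemma key_edge_nonkey_exit V K K' G A : key_edge V K K' G -> chain_exit G = Some A ->
  nonkey V A -> boundary V (component_of V A) K'.
Proof.
  intros (HK & HK' & (_ & d & Hd & HS) & mid & -> & HF) HA Hn. split; auto.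
  destruct mid as [|A' mid].
  - injection HA as ->. destruct (nonkey_not_key V A Hn HK').
  - injection HA as ->. apply Sorted_inv in HS as [HS _].
    destruct (exists_last (l := A :: mid) ltac:(discriminate)) as (m & B & Em).
    rewrite Em in *. rewrite <- app_assoc in HS. simpl in HS. exists B. split.
    + apply Sorted_glue in HS as [HS _].
      apply (chain_connected V d (m ++ [B])); auto; [rewrite <- Em; now left|].
      apply in_app_iff. right. now left.
    + eapply (proj1 (Sorted_pairs _ _) HS m B K' []). reflexivity.
Qed.

Lemma key_edge_nonkey_entry V K K' G A : key_edge V K K' G -> chain_entry G = Some A ->
  nonkey V A -> boundary V (component_of V A) K.
Proof.
  intros (HK & HK' & (_ & d & Hd & HS) & mid & -> & HF) HA Hn. split; auto.
  destruct mid as [|B mid].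
  - injection HA as <-. destruct (nonkey_not_key V K Hn HK).
  - pose proof HS as HS'. apply Sorted_inv in HS' as [HS' Hh].
    exists B. split.
    + apply Sorted_inv in HS as [HS _].
      destruct (exists_last (l := B :: mid) ltac:(discriminate)) as (m & A' & Em).
      rewrite Em in *. rewrite <- app_assoc in *. simpl in *.
      change (K :: m ++ [A'; K']) with ((K :: m) ++ [A'; K']) in HA.
      rewrite chain_entry_app in HA by (simpl; lia). injection HA as ->.
      apply Sorted_glue in HS as [HS _].
      apply (chain_connected V d (m ++ [A])); auto; [apply in_app_iff; right; now left|].
      rewrite <- Em. now left.
    + apply HdRel_inv in Hh. apply neighbor_sym, Hh.
Qed.

(** After the first step each further one is forced, because the interval reached is non-key; both
    chains stop at the first key interval. *)
Lemma chain_deterministic V e : bounded V -> forall m1 m2 x k1 k2,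
  Sorted (side_neighbor V e) (x :: m1 ++ [k1]) -> Sorted (side_neighbor V e) (x :: m2 ++ [k2]) ->
  hd_error (m1 ++ [k1]) = hd_error (m2 ++ [k2]) ->
  Forall (nonkey V) m1 -> Forall (nonkey V) m2 -> key V k1 -> key V k2 -> k1 = k2.
Proof.
  intros Hb. induction m1 as [|a m1 IH]; intros [|b m2] x k1 k2 H1 H2 Hh F1 F2 HK1 HK2;
    simpl in Hh; injection Hh as ->; auto.
  - inversion F2; subst. now destruct (nonkey_not_key V b).
  - inversion F1; subst. now destruct (nonkey_not_key V k2).
  - apply Sorted_inv in H1 as [H1 _], H2 as [H2 _].
    inversion F1; subst. inversion F2; subst.
    apply (IH m2 b k1 k2); auto.
    apply Sorted_inv in H1 as [_ H1], H2 as [_ H2].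
    assert (E : forall m k, HdRel (side_neighbor V e) b (m ++ [k]) ->
      exists y, hd_error (m ++ [k]) = Some y /\ side_neighbor V e b y).
    { intros [|y m] k Hd; apply HdRel_inv in Hd; simpl; eauto. }
    apply E in H1 as (y1 & -> & H1), H2 as (y2 & -> & H2).
    f_equal. eapply nonkey_side_unique; eauto.
Qed.

(* Non-key intervals have at most one neighbor per side, so G' retraces G. *)
Lemma key_edge_back V K K1 K' G G' : bounded V -> key_edge V K K1 G -> key_edge V K1 K' G' ->
  chain_exit G' = chain_entry G -> K' = K.
Proof.
  intros Hb (HK & HK1 & (_ & d & Hd & HS) & mid & -> & HF)
    (_ & HK' & (_ & d' & Hd' & HS') & mid' & -> & HF') E.
  apply (Sorted_side_rev V d (- d)) in HS; auto. rewrite rev_ends in HS.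
  assert (E' : hd_error (mid' ++ [K']) = hd_error (rev mid ++ [K])).
  { assert (E1 : chain_entry (K :: mid ++ [K1]) = hd_error (rev mid ++ [K])).
    { destruct (exists_last (l := K :: mid) ltac:(discriminate)) as (m & A & Em).
      change (K :: mid ++ [K1]) with ((K :: mid) ++ [K1]). rewrite Em, <- app_assoc. simpl.
      rewrite chain_entry_app by (simpl; lia).
      change (rev mid ++ [K]) with (rev (K :: mid)). rewrite Em, rev_app_distr. reflexivity. }
    rewrite <- E1, <- E. unfold chain_exit. now destruct mid'. }
  assert (d' = - d).
  { apply Sorted_inv in HS as [_ HS], HS' as [_ HS'].
    assert (Hh : forall e m k, HdRel (side_neighbor V e) K1 (m ++ [k]) ->
      exists y, hd_error (m ++ [k]) = Some y /\ col y = col K1 + e).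
    { intros e [|y m] k H; apply HdRel_inv in H; simpl; eexists; split; eauto; apply H. }
    apply Hh in HS as (y & Ey & Hy), HS' as (y' & Ey' & Hy').
    rewrite Ey, Ey' in E'. injection E' as ->. lia. }
  subst d'. eapply (chain_deterministic V (- d) Hb mid' (rev mid)); eauto.
  now apply Forall_rev.
Qed.

Lemma component_of_boundary V C A K : is_component V C -> C A ->
  boundary V (component_of V A) K -> boundary V C K.
Proof.
  intros HC HA (HK & I & HI & Hn). split; auto. exists I. split; auto.
  now apply (component_connected V C A I HC HA).
Qed.

Lemma query_keys_nonkey V t I A K : is_interval V I -> in_interval t I -> nonkey V A ->
  component_of V A I -> boundary V (component_of V A) K -> query_keys V t K.
Proof.
  intros HI Ht HA HAI HB. exists I. split; auto. split; auto. right.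
  split; [eapply connected_nonkey; eauto|].
  exists (component_of V A). split; [now apply component_of_is|]. auto.
Qed.

(** * Successors of an expanded state *)

Lemma candidate_in V rep c K Nout K' Nin' G final l x :
  candidate V rep c K Nout K' Nin' G final l -> In x l ->
  exists ext, ~ (N_in (node_of c) <> None /\ Nout = N_in (node_of c)) /\
    waypoint_rule V rep K (N_in (node_of c)) Nout (last_waypoint c) ext /\
    x = Successor c (Node K' Nin' (waypoints (node_of c) ++ ext ++ final) G).
Proof.
  intros [H1 H2 | ext H1 H2] Hx; [easy|]. destruct Hx as [<-|[]]. eauto.
Qed.

Lemma context_chain_leg V C K L G : is_component V C -> context_chain V C K L G ->
  leg V K L (chain_exit G) G.
Proof.
  intros HC HG. destruct (context_chain_nonkey V C K L G HC HG) as (d & mid & Hd & E & HS & _ & HF).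
  right. exists d, mid. auto.
Qed.

Lemma Forall2_in_left {A B} (R : A -> B -> Prop) l l' x : Forall2 R l l' -> In x l ->
  exists y, In y l' /\ R x y.
Proof.
  induction 1 as [|a b l l' Hab H IH]; intros Hx; [easy|]. destruct Hx as [<-|Hx].
  - exists b. split; auto. now left.
  - destruct (IH Hx) as (y & ? & ?). exists y. split; auto. now right.
Qed.

Lemma Forall2_in_right {A B} (R : A -> B -> Prop) l l' y : Forall2 R l l' -> In y l' ->
  exists x, In x l /\ R x y.
Proof.
  induction 1 as [|a b l l' Hab H IH]; intros Hx; [easy|]. destruct Hx as [<-|Hx].
  - exists a. split; auto. now left.
  - destruct (IH Hx) as (x & ? & ?). exists x. split; auto. now right.
Qed.

(** If the entry lay in the component of [t], the edge would make [K] a boundary interval of that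
    component, hence a target key interval, and [K] would not be expanded along edges. *)
Lemma expands_edge_inv V rep s t c K G K' l x : bounded V -> valid_gap_choice V rep ->
  open_inv V s c K -> ~ query_keys V t K -> key_edge V K K' G ->
  candidate V rep c K (chain_exit G) (Some K') (chain_entry G) G [] l -> In x l ->
  state_inv V s t x.
Proof.
  intros Hb Hrep Hinv HQ HG Hcand Hx.
  destruct (candidate_in _ _ _ _ _ _ _ _ _ _ _ Hcand Hx) as (ext & Hnd & Hrule & ->).
  unfold state_inv. cbn [node_of key_of]. split; [eapply successor_open_inv; eauto|].
  intros A I HA Hn HI Ht HAI. cbn in HA. apply HQ.
  apply (query_keys_nonkey V t I A K); auto. eapply key_edge_nonkey_entry; eauto.
Qed.

(** The terminal candidate is never discarded: its exit is either undefined or a non-key interval of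
    the component of [t], which [entry_free] excludes as incoming interval. *)
Lemma expands_target V rep s t c K succs : bounded V -> valid_gap_choice V rep ->
  open_inv V s c K -> entry_free V t c -> key_of (node_of c) = Some K -> query_keys V t K ->
  expands V rep t c succs ->
  exists x, succs = [x] /\ key_of (node_of x) = None /\ state_inv V s t x.
Proof.
  intros Hb Hrep Hinv Hfree HK HQ Hexp.
  destruct Hexp as [K0 Gs ls H1 H2 _ _ _ | K0 l H1 H2 H3 H4 | K0 It C G l H1 H2 HIt Ht Hne HC HCI HG H4];
    rewrite HK in H1; injection H1 as <-; [easy| |].
  - destruct H4 as [HN HE | ext HN Hrule]; [congruence|].
    eexists. split; [reflexivity|]. split; [reflexivity|].
    eapply (successor_terminal_inv V rep s t c K K None [K]); eauto.
    + apply Hinv.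
    + left. auto.
  - pose proof (context_chain_leg V C K It G HC HG) as Hleg.
    destruct H4 as [HN HE | ext HN Hrule].
    + exfalso. destruct HG as (_ & _ & _ & _ & mid & -> & HF).
      assert (HA : exists A, chain_exit (K :: mid ++ [It]) = Some A /\ C A).
      { destruct mid as [|A mid]; eexists; split; try reflexivity; auto. now inversion HF. }
      destruct HA as (A & EA & HA). rewrite EA in HE.
      apply (Hfree A It); auto; [eapply component_nonkey; eauto|].
      now apply (component_connected V C A It HC HA).
    + eexists. split; [reflexivity|]. split; [reflexivity|].
      eapply (successor_terminal_inv V rep s t c K It (chain_exit G) G); eauto.
Qed.

Lemma expands_edges_inv V rep s t c K succs : bounded V -> valid_gap_choice V rep ->
  open_inv V s c K -> key_of (node_of c) = Some K -> ~ query_keys V t K ->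
  expands V rep t c succs ->
  (forall x, In x succs -> state_inv V s t x /\ exists K' G, key_of (node_of x) = Some K' /\
     key_edge V K K' G /\ N_in (node_of x) = chain_entry G) /\
  (forall K' G, key_edge V K K' G -> chain_exit G = N_in (node_of c) \/
     exists x, In x succs /\ key_of (node_of x) = Some K').
Proof.
  intros Hb Hrep Hinv HK HQ Hexp.
  destruct Hexp as [K0 Gs ls H1 H2 _ HGs Hls | K0 l H1 H2 _ _ | K0 It C G l H1 H2 _ _ _ _ _ _ _];
    rewrite HK in H1; injection H1 as <-; [|easy|easy].
  split.
  - intros x Hx. apply in_concat in Hx as (l & Hl & Hx).
    destruct (Forall2_in_right _ _ _ _ Hls Hl) as (G & HG & K' & HKG & Hcand).
    split; [eapply expands_edge_inv; eauto|].
    destruct (candidate_in _ _ _ _ _ _ _ _ _ _ _ Hcand Hx) as (ext & _ & _ & ->).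
    exists K', G. auto.
  - intros K' G HKG.
    destruct (Forall2_in_left _ _ _ G Hls) as (l & Hl & K'' & HKG' & Hcand); [apply HGs; eauto|].
    destruct Hcand as [_ HE | ext _ Hrule]; [now left|]. right.
    eexists. split; [apply in_concat; eexists; split; [exact Hl | now left]|]. simpl.
    destruct HKG as (_ & _ & _ & m1 & E1 & _), HKG' as (_ & _ & _ & m2 & E2 & _).
    rewrite E1 in E2. injection E2 as E2. apply app_inj_tail in E2 as [_ ->]. reflexivity.
Qed.

(** The expanded state becomes settled: each edge either has a successor, whose key interval is then
    visited, or is the refused one and leads to a visited key interval by [entry_visited]. *)
Lemma search_inv_step V rep s t op ret c l1 l2 succs op' ret' :
  bounded V -> valid_gap_choice V rep -> search_inv V s t op ret -> op = l1 ++ c :: l2 ->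
  last_waypoint c <> t -> expands V rep t c succs ->
  fold_left insert_state succs (l1 ++ l2, ret) = (op', ret') -> search_inv V s t op' ret'.
Proof.
  intros Hb Hrep [Ist Iret Ient Icomp] -> Hlast Hexp Hfold.
  pose proof (fold_insertion _ _ _ _ _ Hfold) as [F1 F2 F3 F4 F5 F6].
  assert (Hin : In c (l1 ++ c :: l2)) by (apply in_app_iff; right; now left).
  assert (Hsub : forall x, In x (l1 ++ l2) -> In x (l1 ++ c :: l2)).
  { intros x Hx. apply in_app_iff in Hx. apply in_app_iff. simpl. tauto. }
  assert (Hrest : forall x, In x (l1 ++ c :: l2) -> x = c \/ In x (l1 ++ l2)).
  { intros x Hx. apply in_app_iff in Hx. rewrite in_app_iff. simpl in Hx. intuition. }
  pose proof (Ist c Hin) as Hc. unfold state_inv in Hc.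
  destruct (key_of (node_of c)) as [K|] eqn:HK; [|easy].
  destruct Hc as [Hopen Hfree].
  assert (HvK : visited ret K).
  { exists c. split; auto. apply Iret; auto. congruence. }
  assert (Hsuccs : forall x, In x succs -> state_inv V s t x /\
    forall K1, key_of (node_of x) = Some K1 -> entry_visited V ret x K1).
  { intros x Hx. destruct (classic (query_keys V t K)) as [HQ|HQ].
    - destruct (expands_target V rep s t c K succs) as (y & -> & H1 & H2); auto.
      destruct Hx as [<-|[]]. split; auto. congruence.
    - destruct (expands_edges_inv V rep s t c K succs) as [H _]; auto.
      destruct (H x Hx) as (H1 & K1 & G & HK1 & HG & HN). split; auto.
      intros K2 HK2 K' G' HG' HE. rewrite HK1 in HK2. injection HK2 as <-.
      (* The exit refused by a successor retraces its own edge back to [K], which is already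
         visited. *)
      rewrite HN in HE. assert (K' = K) by (eapply key_edge_back; eauto). now subst. }
  split.
  - intros x Hx. destruct (F1 x Hx) as [H|H]; auto. now apply Hsuccs.
  - apply F5. intros x Hx. apply Iret. auto.
  - intros x K1 Hx HK1 K' G HG HE. apply F2. destruct (F1 x Hx) as [H|H].
    + exact (Ient x K1 (Hsub x H) HK1 K' G HG HE).
    + apply Hsuccs in H as [_ H]. exact (H K1 HK1 K' G HG HE).
  - destruct Icomp as [(x & Hx & Ex)|[Icomp Iseed]].
    { left. exists x. split; auto. apply F6; auto. left.
      destruct (Hrest x Hx) as [->|]; auto. congruence. }
    destruct (classic (query_keys V t K)) as [HQ|HQ].
    { left. destruct (expands_target V rep s t c K succs) as (y & -> & H1 & H2); auto.
      exists y. split; auto. apply F6; auto. right. now left. }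
    right. split; [|auto]. intros x Kx Hx HKx.
    destruct (F4 x Hx) as [|[Hx1 Hx2]]; auto. right.
    destruct (Icomp x Kx Hx1 HKx) as [Hop|[S1 S2]]; [|split; eauto].
    destruct (Hrest x Hop) as [->|]; [|easy].
    rewrite HK in HKx. injection HKx as <-. split; auto. intros K' G HG.
    destruct (expands_edges_inv V rep s t c K succs) as [_ H]; auto.
    destruct (H K' G HG) as [HE|(y & Hy & EY)]; [apply F2; exact (Ient c K Hin HK K' G HG HE) | eapply F3; eauto].
Qed.

Lemma search_inv_initial V s t l : bounded V -> (forall C, ~ share_context V C s t) ->
  initial_states V s l -> search_inv V s t l l.
Proof.
  intros Hb Hno (I & HI & Hs & Hl).
  assert (Hseed : forall K, query_keys V s K ->
    (key V I /\ K = I) \/ exists C, is_component V C /\ C I /\ boundary V C K).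
  { intros K (I' & HI' & Hs' & H). assert (I' = I) by (eapply interval_unique; eauto). subst.
    destruct H as [H|(_ & H)]; auto. }
  destruct Hl as [[HK ->]|(Hn & C & Ks & HC & HCI & HKs1 & HKs2 & Hl)].
  - split.
    + intros c [<-|[]]. split; [now apply initial_key_inv|]. intros A J E. discriminate.
    + intros c Hc _. exact Hc.
    + intros c K [<-|[]] _ K' G (_ & _ & _ & mid & -> & _) E.
      destruct mid; discriminate.
    + right. split; auto. intros K HQ. destruct (Hseed K HQ) as [[_ ->]|(C & HC & HCI & _)].
      * eexists. split; [now left | reflexivity].
      * now destruct (nonkey_not_key V I (component_nonkey V C I HC HCI)).
  - assert (Hc : forall c, In c l -> exists K G, key_of (node_of c) = Some K /\ boundary V C K /\
      context_chain V C I K G /\ c = Initial (Node (Some K) (chain_entry G) [s] G)).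
    { intros c Hc. destruct (Forall2_in_right _ _ _ _ Hl Hc) as (K & HK & G & HG & ->).
      exists K, G. split; auto. split; auto. now apply HKs2. }
    assert (Hv : forall K, boundary V C K -> visited l K).
    { intros K HK. apply HKs2 in HK.
      destruct (Forall2_in_left _ _ _ _ Hl HK) as (c & Hcl & G & HG & ->).
      eexists. split; eauto. }
    assert (Hentry : forall c, In c l -> exists A, N_in (node_of c) = Some A /\ C A).
    { intros c Hcl. destruct (Hc c Hcl) as (K & G & _ & _ & (_ & _ & _ & _ & mid & -> & HF) & ->).
      cbn [node_of N_in]. destruct (exists_last (l := I :: mid) ltac:(discriminate)) as (m & A & Em).
      exists A. change (I :: mid ++ [K]) with ((I :: mid) ++ [K]). rewrite Em, <- app_assoc.
      simpl. rewrite chain_entry_app by (simpl; lia). split; auto.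
      assert (HA : In A (I :: mid)) by (rewrite Em; apply in_app_iff; right; now left).
      destruct HA as [<-|HA]; auto. rewrite Forall_forall in HF. auto. }
    split.
    + intros c Hcl. destruct (Hc c Hcl) as (K & G & EK & HB & HG & Ec).
      unfold state_inv. rewrite EK. split; [subst; eapply initial_nonkey_inv; eauto; apply HB|].
      intros A J EA HnA HJ Ht HAJ. destruct (Hentry c Hcl) as (A' & EA' & HA).
      (* The entry of an initial state lies in the component of [s]; were [t] in it too, [s] and [t]
         would share a context. *)
      rewrite EA in EA'. injection EA' as <-. apply (Hno C). split; auto.
      split; [exists I; repeat split; auto; try apply HI; try apply Hs; now left|].
      exists J. split; auto. split; auto. left. now apply (component_connected V C A J HC HA).
    + intros c Hcl _. exact Hcl.
    (* A refused exit leads through the component of [s] to one of its boundary intervals, and all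
       of these are seeded. *)
    + intros c K Hcl HK K' G HG E. destruct (Hentry c Hcl) as (A & EA & HA). rewrite EA in E.
      apply Hv. apply (component_of_boundary V C A K' HC HA).
      eapply key_edge_nonkey_exit; eauto. eapply component_nonkey; eauto.
    + right. split; auto. intros K HQ. apply Hv. destruct (Hseed K HQ) as [[HKI _]|(C' & HC' & HCI' & HB)].
      * destruct (nonkey_not_key V I Hn HKI).
      * apply (component_of_boundary V C I K HC HCI).
        destruct HB as (HK & J & HJ & HJn). split; auto. exists J. split; auto.
        now apply (component_connected V C' I J HC' HCI').
Qed.

(** * Reachability through visited key intervals *)

Lemma adjacent_intervals V I J u v : is_interval V I -> is_interval V J ->
  in_interval u I -> in_interval v J -> adjacent u v -> I = J \/ neighbor V I J.
Proof.
  intros HI HJ [Eu Hu] [Ev Hv] Hadj. unfold adjacent, manhattan in Hadj.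
  destruct u as [x y], v as [x' y']; simpl in *; subst x x'.
  destruct (Z.eq_dec (col I) (col J)) as [E|Hne].
  - left. destruct (Z.lt_trichotomy (ys I) (ys J)) as [H|[H|H]].
    + apply (interval_order V I J HI HJ E) in H. lia.
    + apply (interval_row_unique V I J (ys I)); auto; destruct HI, HJ; lia.
    + apply (interval_order V J I HJ HI) in H; auto. lia.
  - right. refine (conj HI (conj HJ (conj _ _))); [lia|]. exists y. lia.
Qed.

Lemma settled_unreachable V s t ret p : bounded V -> (forall C, ~ share_context V C s t) ->
  (forall K, visited ret K -> settled V t ret K) ->
  (forall K, query_keys V s K -> visited ret K) -> walk V s t p -> False.
Proof.
  intros Hb Hno Hset Hseed Hw.
  destruct (interval_exists V s Hb) as (Is & HIs & Hs); [now inversion Hw|].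
  (* A non-key interval counts as reached if it lies in the component of [s] or its own component
     borders a visited key interval. This property and that of being visited pass to neighbors. *)
  set (reached := fun I => (key V I -> visited ret I) /\
    (nonkey V I -> component_of V Is I /\ nonkey V Is \/
       exists K, visited ret K /\ boundary V (component_of V I) K)).
  assert (Hstep : forall I J, reached I -> neighbor V I J -> reached J).
  { intros I J [R1 R2] Hn.
    pose proof Hn as (HI & HJ & _).
    destruct (classic (key V I)) as [HkI|HkI].
    - specialize (R1 HkI). split.
      + intros HkJ. apply (Hset I R1) with (G := [I; J]).
        destruct (neighbor_side V I J Hn) as (d & Hd & HIJ).
        split; auto. split; auto. split; [split; [simpl; lia|exists d; split; auto]|].
        exists []. auto.
      + intros HnJ. right. exists I. split; auto. split; auto. exists J. split; [apply rt_refl|].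
        now apply neighbor_sym.
    - assert (HnI : nonkey V I) by (split; auto). specialize (R2 HnI). split.
      + intros HkJ.
        assert (HBJ : boundary V (component_of V I) J)
          by (split; auto; exists I; split; auto; apply rt_refl).
        destruct R2 as [[Hc HnIs]|(K & HvK & HBK)].
        * apply Hseed. exists Is. split; auto. split; auto. right. split; auto.
          exists (component_of V Is). split; [now apply component_of_is|]. split; [apply rt_refl|].
          apply (component_of_boundary V _ I); auto. now apply component_of_is.
        (* Two distinct boundary intervals of one component are joined through it, which is an edge;
           [K] is settled, so [J] is visited. *)
        * destruct (interval_eq_dec K J) as [->|Hne]; auto.
          pose proof (component_of_is V I HnI) as HC.
          destruct (context_chain_exists V (component_of V I) K J Hb HC) as [G HG]; auto;
            try (now right).
          apply (Hset K HvK) with (G := G).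
          destruct (context_chain_nonkey V _ K J G HC HG) as (d & mid & Hd & E & HS & _ & HF).
          split; [apply HBK|]. split; auto. split; [apply HG|]. eauto.
      + intros HnJ.
        assert (HIJ : component_of V I J) by (apply rt_step; exact (conj HnI (conj HnJ Hn))).
        destruct R2 as [[Hc HnIs]|(K & HvK & HBK)].
        * left. split; auto. eapply rt_trans; eauto.
        * right. exists K. split; auto.
          apply (component_of_boundary V (component_of V J) I); auto;
            [now apply component_of_is | now apply connected_sym]. }
  assert (Hwalk : forall u v q, walk V u v q -> forall I, is_interval V I -> in_interval u I ->
    reached I -> exists J, is_interval V J /\ in_interval v J /\ reached J).
  { induction 1 as [v Hv | u u' v q Hu Hadj Hq IH]; intros I HI HuI HR; [eauto|].
    destruct (interval_exists V u' Hb) as (J & HJ & HuJ); [now inversion Hq|].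
    apply (IH J); auto. destruct (adjacent_intervals V I J u u') as [->|Hn]; auto.
    apply (Hstep I); auto. }
  destruct (Hwalk s t p Hw Is HIs Hs) as (It & HIt & Ht & R1 & R2).
  - split.
    + intros HK. apply Hseed. exists Is. auto.
    + intros Hn. left. split; auto. apply rt_refl.
  (* Reaching the interval of [t] contradicts the hypotheses: a visited target key interval is not
     settled, and otherwise [s] and [t] share a context. *)
  - destruct (classic (key V It)) as [HK|HK].
    + apply (Hset It (R1 HK)). exists It. auto.
    + assert (Hn : nonkey V It) by (split; auto).
      destruct (R2 Hn) as [[Hc HnIs]|(K & HvK & HBK)].
      * apply (Hno (component_of V Is)). split; [now apply component_of_is|].
        split; [exists Is | exists It]; repeat (split; auto); left; auto; apply rt_refl.
      * apply (Hset K HvK). apply (query_keys_nonkey V t It It); auto. apply rt_refl.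
Qed.

(** * Outcome of all runs *)

Definition outcome (V : grid) (s t : cell) (o : config) : Prop :=
  (exists p, o = Returned p /\ valid_path V s t p) \/
  (o = Failed /\ ~ exists p, valid_path V s t p).

Lemma min_f_exists t op : op <> [] -> exists c rest, extracts_min t op c rest.
Proof.
  intros Hne. destruct (argmin (f_value t) (fun c => In c op)
    (* Any lower bound serves; this one is the minimum of 0 and all values of [f]. *)
    (fold_right (fun c m => Z.min (f_value t c) m) 0 op)) as (c & Hc & Hmin).
  - destruct op as [|c op]; [easy|]. exists c. now left.
  - clear Hne. induction op as [|a op IH]; intros c Hc; [easy|].
    simpl. destruct Hc as [->|Hc]; [lia|]. specialize (IH c Hc). cbv beta in IH. lia.
  - destruct (in_split c op Hc) as (l1 & l2 & E). exists c, (l1 ++ l2). split; eauto.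
Qed.

(** Lexicographic induction on empty slots, sum of the finite minima and weight of the open list. *)
Lemma search_inevitable V s t rep : bounded V -> V s = true -> valid_gap_choice V rep ->
  (forall C, ~ share_context V C s t) -> forall op ret, search_inv V s t op ret ->
  inevitably (step V s t) (outcome V s t) (Searching rep op ret).
Proof.
  intros Hb Hs Hrep Hno. destruct (intervals_finite V Hb) as (ints & _ & Hints).
  set (Q := row_slots ints).
  assert (main : forall n1 n2 n3 op ret, n1 = unseen Q (best_cost ret) ->
    n2 = total Q (best_cost ret) -> n3 = weight op -> search_inv V s t op ret ->
    inevitably (step V s t) (outcome V s t) (Searching rep op ret)); [|eauto].
  refine (lex_induction _ _). intros n1 n2 n3 IH op ret -> -> -> Hinv.
  assert (Hpath : forall c, In c op -> path_inv V s c).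
  { intros c Hc. apply (inv_state _ _ _ _ _ Hinv) in Hc. unfold state_inv in Hc.
    destruct (key_of (node_of c)); [apply Hc | apply Hc]. }
  assert (Hkey : forall c, In c op -> last_waypoint c <> t ->
    exists K, key_of (node_of c) = Some K /\ open_inv V s c K /\ entry_free V t c).
  { intros c Hc Hl. apply (inv_state _ _ _ _ _ Hinv) in Hc. unfold state_inv in Hc.
    destruct (key_of (node_of c)) as [K|]; [eauto | tauto]. }
  apply inevitably_next.
  - destruct op as [|c0 op0]; [eexists; apply step_empty|].
    destruct (min_f_exists t (c0 :: op0) ltac:(discriminate)) as (c & rest & Hmin).
    assert (Hin : In c (c0 :: op0)).
    { destruct Hmin as [(l1 & l2 & -> & _) _]. apply in_app_iff. right. now left. }
    destruct (classic (last_waypoint c = t)) as [Hl|Hl].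
    + destruct (reconstructs_exists V s c Hb Hs (Hpath c Hin)) as [p Hp].
      eexists. eapply step_return; eauto.
    + destruct (Hkey c Hin Hl) as (K & HK & _).
      destruct (expands_exists V rep t c K Hb HK) as [succs Hsu].
      destruct (fold_left insert_state succs (rest, ret)) as [op' ret'] eqn:E.
      eexists. eapply step_expand; eauto.
  - intros o Ho. inversion Ho as [| | | rep0 ret0 Eo | rep0 op0 ret0 c rest p Hmin Hl Hp |
      rep0 op0 ret0 c rest succs op' ret' Hmin Hl Hexp Hfold]; subst.
    + apply inevitably_now. right. split; auto. intros [p Hp]. apply walk_valid in Hp.
      destruct (inv_complete _ _ _ _ _ Hinv) as [(c & [] & _)|[Hset Hseed]].
      apply (settled_unreachable V s t ret p); auto.
      intros K (c & Hc & HK). destruct (Hset c K Hc HK) as [[]|]; auto.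
    + apply inevitably_now. left. exists p. split; auto. apply walk_valid.
      eapply reconstructs_walk; eauto. apply Hpath.
      destruct Hmin as [(l1 & l2 & -> & _) _]. apply in_app_iff. right. now left.
    + destruct Hmin as [(l1 & l2 & -> & ->) _].
      assert (Hin : In c (l1 ++ c :: l2)) by (apply in_app_iff; right; now left).
      pose proof (search_inv_step V rep s t _ ret c l1 l2 succs op' ret' Hb Hrep Hinv eq_refl Hl
        Hexp Hfold) as Hinv'.
      destruct (Hkey c Hin Hl) as (K & HK & Hopen & Hfree).
      eapply IH; try reflexivity; auto.
      rewrite weight_app. change (c :: l2) with ([c] ++ l2). rewrite weight_app.
      unfold weight at 3. simpl. rewrite HK.
      destruct (classic (query_keys V t K)) as [HQ|HQ].
      * destruct (expands_target V rep s t c K succs) as (y & -> & H1 & _); auto.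
        cbn [fold_left] in Hfold. unfold insert_state in Hfold. rewrite H1 in Hfold.
        injection Hfold as <- <-. right. split; auto. right. split; auto.
        rewrite !weight_app. unfold weight at 3. simpl. rewrite H1. lia.
      * destruct (expands_edges_inv V rep s t c K succs) as [H _]; auto.
        (* Either every successor was dominated, so the open list just loses [c], or some minimum
           over the retained states fell. *)
        destruct (fold_potential Q succs) with (op := l1 ++ l2) (ret := ret) (op' := op') (ret' := ret')
          as [[-> ->]|Hlt]; auto.
        -- intros x Hx. destruct (H x Hx) as (_ & K' & G & HK' & (_ & HKK & _) & _).
           exists K'. split; auto. eapply in_row_slots; [apply Hints|]; apply HKK.
        -- right. split; auto. right. split; auto. rewrite weight_app. lia.
        -- destruct Hlt as [Hlt|[-> Hlt]]; auto.
Qed.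

Lemma start_inevitable V s t : bounded V -> V s = true -> V t = true ->
  inevitably (step V s t) (outcome V s t) Start.
Proof.
  intros Hb Hs Ht. apply inevitably_next.
  { destruct (gap_choice_exists V Hb) as [rep Hrep]. eexists. apply step_preprocess, Hrep. }
  intros o Ho. inversion Ho as [rep Hrep | | | | |]; subst. apply inevitably_next.
  - destruct (classic (exists C, share_context V C s t)) as [[C HC]|Hno].
    + destruct (segment_exists V [] s t Hb Hs Ht) as [p Hp].
      eexists. eapply step_direct; eauto.
    + destruct (initial_states_exists V s Hb Hs) as [l Hl].
      eexists. apply step_initialize; eauto.
  - intros o' Ho'. inversion Ho' as [| rep0 C p HC Hp | rep0 l Hno Hl | | |]; subst.
    + apply inevitably_now. left. exists p. split; auto. apply walk_valid.
      eapply segment_context_free_walk; eauto.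
    + apply search_inevitable; auto. now apply search_inv_initial.
Qed.

Lemma inevitably_weaken {A} (R : A -> A -> Prop) (Q Q' : A -> Prop) x :
  (forall y, Q y -> Q' y) -> inevitably R Q x -> inevitably R Q' x.
Proof.
  intros H. induction 1 as [x Hx | x Hex Hall IH]; [now apply inevitably_now; auto|].
  now apply inevitably_next.
Qed.

Theorem theorem2 (M N : nat) (V : grid) (s t : cell)
    (hV : in_grid M N V) (hs : V s = true) (ht : V t = true) :
  ((exists p, valid_path V s t p) ->
     inevitably (step V s t)
       (fun o => exists p, o = Returned p /\ valid_path V s t p) Start) /\
  (~ (exists p, valid_path V s t p) ->
     inevitably (step V s t) (fun o => o = Failed) Start).
Proof.
  assert (H : inevitably (step V s t) (outcome V s t) Start).
  { apply start_inevitable; auto. now exists M, N. }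
  split; intros Hp; eapply inevitably_weaken; try exact H; intros o [Ho|[-> Ho]]; auto.
  - easy.
  - destruct Ho as (p & _ & Hv). destruct Hp. eauto.
Qed.
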